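(* For every $n$, let $A_n=(a_{\lambda\mu})_{\lambda,\mu\in P_n}$ be defined by $$S_\lambda(x,x)=\sum_{\mu\in P_n}a_{\lambda\mu}\,Q_{\mu^r}(x)\,S_{\mu^d}(x^2)\qquad(\lambda\in P_n).$$ Then $$|\det A_n|=2^{k_n},\qquad\text{where}\qquad k_n=\sum_{\lambda\in P_n}\ell(\lambda^e)=\sum_{\lambda\in P_n}\bigl(\ell(\widetilde{\lambda^r})-\ell(\lambda^r)\bigr).$$
   Context: $P_n$ is the set of partitions of $n$; $\ell(\lambda)$ is the number of parts of $\lambda$. For a partition $\lambda$ let $m_i(\lambda)$ be the multiplicity of $i$ as a part of $\lambda$. Define $\lambda^r$ to be the strict partition (distinct parts) with $m_i(\lambda^r)=1$ if $m_i(\lambda)$ is odd and $0$ if $m_i(\lambda)$ is even. Define $\lambda^d$ to be the partition with $m_i(\lambda^d)=\frac12(m_i(\lambda)-1)$ if $m_i(\lambda)$ is odd and $\frac12 m_i(\lambda)$ if $m_i(\lambda)$ is even. Define $\lambda^e$ to be the partition obtained by taking halves of the even parts of $\lambda$. Glaisher map: for a strict partition $\lambda=(\lambda_1,\lambda_2,\ldots)$ of $m$ with $\lambda_i=2^{p_i}q_i$, $q_i$ odd, $\widetilde\lambda$ is the partition of $m$ into odd parts with $m_{2j-1}(\widetilde\lambda)=\sum_{i:\,q_i=2j-1}2^{p_i}$ for $j\geq 1$. $S_\nu(x)$ is the ordinary Schur function in $x=(x_1,x_2,\ldots)$. We write $(x,x)=(x_1,x_1,x_2,x_2,\ldots)$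 and $x^2=(x_1^2,x_2^2,\ldots)$; thus $S_\lambda(x,x)$ is obtained from $S_\lambda$ by replacing each power sum $p_j$ by $2p_j(x)$, and $S_\nu(x^2)$ by replacing each $p_j$ by $p_{2j}(x)$. For a strict partition $\mu$, $Q_\mu(x)$ is Schur's $Q$-function (the Hall–Littlewood function $Q_\mu(x;t)$ at $t=-1$, in the standard normalization of Macdonald's book). The functions $Q_{\mu^r}(x)S_{\mu^d}(x^2)$, $\mu\in P_n$, form a basis of the space of homogeneous symmetric functions of degree $n$ over $\mathbb{C}$, so the $a_{\lambda\mu}$ are well defined. *)

(* Defs.v *)
From HB Require Import structures.
From mathcomp Require Import all_boot all_order all_fingroup all_algebra.
From mathcomp Require Import mpoly.

Set Implicit Arguments.
Unset Strict Implicit.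
Unset Printing Implicit Defensive.

Import Order.TTheory GRing.Theory Num.Theory.
Local Open Scope nat_scope.

Definition is_part (s : seq nat) : bool := sorted geq s && (0 \notin s).

(* A partition of n has at most n parts, all at most n: the bounds in the
   carrier only serve to obtain a finite type. *)
Record intpart (n : nat) := IntPart {
  bparts : n.-bseq 'I_n.+1;
  _ : is_part [seq nat_of_ord i | i <- bparts] &&
      (sumn [seq nat_of_ord i | i <- bparts] == n) }.

HB.instance Definition _ (n : nat) := [isSub for @bparts n].
HB.instance Definition _ (n : nat) := [Finite of intpart n by <:].

Coercion parts (n : nat) (la : intpart n) : seq nat :=
  [seq nat_of_ord i | i <- bparts la].

(* The partition with m i parts equal to i for 1 <= i <= b. *)
Definition part_of_mult (b : nat) (m : nat -> nat) : seq nat :=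
  flatten [seq nseq (m i) i | i <- rev (iota 1 b)].

Definition part_r (la : seq nat) : seq nat :=
  part_of_mult (sumn la) (fun i => odd (count_mem i la)).

Definition part_d (la : seq nat) : seq nat :=
  part_of_mult (sumn la) (fun i => (count_mem i la)./2).

Definition part_e (la : seq nat) : seq nat :=
  [seq i./2 | i <- la & ~~ odd i].

(* For i = 2 ^ p * q with q odd, p = logn 2 i and q = i`_2^'. *)
Definition glaisher (la : seq nat) : seq nat :=
  part_of_mult (sumn la)
    (fun j => if odd j then \sum_(i <- la | i`_2^' == j) 2 ^ logn 2 i else 0).

Local Open Scope ring_scope.

Section Alternant.
Variables (S : comNzRingType) (N : nat) (x : 'I_N -> S).

(* a_alpha = det (x_i ^ alpha_j) *)
Definition alternant (alpha : nat -> nat) : S :=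
  \det (\matrix_(i < N, j < N) x i ^+ alpha j).

Definition delta (j : nat) : nat := (N - j.+1)%N.

(* The coefficients of the remainder of 'X^m by \prod_i ('X - x_i) express
   x_i ^ m as a combination of 1, x_i, ..., x_i ^ (N - 1). *)
Lemma alternant_dvd (alpha : nat -> nat) :
  exists s : S, s * alternant delta == alternant alpha.
Proof.
pose g : {poly S} := \prod_(i < N) ('X - (x i)%:P).
have g_monic : g \is monic by apply: monic_prod => i _; apply: monicXsubC.
have size_g : size g = N.+1.
  by rewrite /g size_prod_XsubC /index_enum -enumT size_enum_ord.
pose r m := Pdiv.Ring.rmodp 'X^m g.
have root_g (i : 'I_N) : g.[x i] = 0.
  by rewrite /g horner_prod (bigD1 i) //= hornerXsubC subrr mul0r.
have rE (i : 'I_N) m : x i ^+ m = (r m).[x i].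
  have := congr1 (horner^~ (x i)) (Pdiv.RingMonic.rdivp_eq g_monic 'X^m).
  by rewrite hornerXn hornerD hornerM root_g mulr0 add0r.
have size_r m : (size (r m) <= N)%N.
  by rewrite -ltnS -size_g Pdiv.Ring.ltn_rmodpN0 ?monic_neq0.
exists (\det (\matrix_(k < N, j < N) (r (alpha j))`_(delta k))).
apply/eqP; rewrite mulrC -det_mulmx; congr (\det _).
apply/matrixP=> i j; rewrite !mxE rE (horner_coef_wide _ (size_r _)).
rewrite (reindex_inj rev_ord_inj) /=; apply: eq_bigr => k _.
have deltaK : delta (rev_ord k) = k by have := congr1 val (rev_ordK k).
by rewrite !mxE deltaK mulrC.
Qed.

End Alternant.

Section Schur.
Variables (R : comNzRingType) (N : nat).

(* The Schur polynomial a_(la + delta) / a_delta in N variables. The quotient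
   is unique, since a_delta is not a zero divisor. *)
Definition schur (la : seq nat) : {mpoly R[N]} :=
  if (size la <= N)%N
  then xchoose (alternant_dvd (fun i : 'I_N => 'X_i : {mpoly R[N]})
                  (fun j => nth 0%N la j + delta N j)%N)
  else 0.

End Schur.

Arguments schur R N la : clear implicits.

Section SchurSubst.
Variables (R : comNzRingType) (N : nat).

Lemma half_ord_subproof (i : 'I_N.*2) : (i./2 < N)%N.
Proof. by rewrite ltn_half_double. Qed.

Definition half_ord (i : 'I_N.*2) : 'I_N := Ordinal (half_ord_subproof i).

(* S_la(x_1, x_1, ..., x_N, x_N) *)
Definition schur_dup (la : seq nat) : {mpoly R[N]} :=
  comp_mpoly [tuple 'X_(half_ord i) | i < N.*2] (schur R N.*2 la).

(* S_la(x_1 ^ 2, ..., x_N ^ 2) *)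
Definition schur_sq (la : seq nat) : {mpoly R[N]} :=
  comp_mpoly [tuple 'X_i ^+ 2 | i < N] (schur R N la).

End SchurSubst.

Arguments schur_dup R N la : clear implicits.
Arguments schur_sq R N la : clear implicits.

Section HallLittlewood.
Variables (F : fieldType) (N : nat) (t : F) (x : 'I_N -> F).

(* Macdonald's sum over w in S_N / S_N^la of
     w (x^la * \prod_(la_i > la_j) (x_i - t x_j) / (x_i - x_j)).
   The summand depends only on the rearrangement alpha = w la of
   (la_1, ..., la_l, 0, ..., 0), so that cosets are replaced by distinct
   rearrangements. In contrast with the sum over the whole of S_N divided by
   v_la(t), this makes sense at t = -1. *)
Definition hallP (la : seq nat) : F :=
  if (size la <= N)%N then
    \sum_(alpha <- permutations (la ++ nseq (N - size la) 0%N))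
      (\prod_(i < N) x i ^+ nth 0%N alpha i) *
      \prod_(i < N) \prod_(j < N | (nth 0%N alpha j < nth 0%N alpha i)%N)
        ((x i - t * x j) / (x i - x j))
  else 0.

(* b_la(t) = \prod_i phi_(m_i(la))(t) *)
Definition hallb (la : seq nat) : F :=
  \prod_(i <- undup la) \prod_(1 <= k < (count_mem i la).+1) (1 - t ^+ k).

Definition hallQ (la : seq nat) : F := hallb la * hallP la.

End HallLittlewood.

Local Notation "p %:F" := (FracField.tofrac p).

Definition schurQ (R : idomainType) (N : nat) (mu : seq nat) :
    {fraction {mpoly R[N]}} :=
  hallQ (-1) (fun i : 'I_N => ('X_i : {mpoly R[N]})%:F) mu.

Arguments schurQ R N mu : clear implicits.

(* The defining relation of A_n. An equality of symmetric functions in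
   infinitely many variables means that it holds in N variables for all N. *)
Definition is_transition (C : fieldType) (n : nat)
    (A : 'M[C]_#|{: intpart n}|) : Prop :=
  forall (N : nat) (la : intpart n),
    (schur_dup C N la)%:F =
    \sum_(mu : intpart n)
      ((A (enum_rank la) (enum_rank mu))%:MP)%:F *
      (schurQ C N (part_r mu) * (schur_sq C N (part_d mu))%:F).

Definition kn (n : nat) : nat := (\sum_(la : intpart n) size (part_e la))%N.

(* Main.v *)
Require Import Defs.
From mathcomp Require Import all_boot all_order all_fingroup all_algebra.
From mathcomp Require Import mpoly zify ring.

Set Implicit Arguments.
Unset Strict Implicit.
Unset Printing Implicit Defensive.

Import Order.TTheory GRing.Theory Num.Theory.
Local Open Scope ring_scope.

(** With h_r the complete symmetric functions, q_r = Q_(r), and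
    hh_r = h_r(x, x), the generating series satisfy
    H(t)^2 = (H(t) / H(-t)) * (H(t) H(-t)), that is
    hh_r = \sum_k q_(r - 2k) h_k(x^2).
    Everything is read on the coefficients of the monomials x^la, la |- n, in
    n variables; write [f] for the matrix of these coefficients of a family f.
    The Cauchy identities for S and Q combine to
    [hh] = [QS]^T D^-1 [QS], where D is diagonal with entries
    2^l(mu^r) and QS_mu = Q_(mu^r) S_(mu^d)(x^2).
    By Jacobi-Trudi S_la(x, x) is hh_la plus terms hh_nu with nu > la, so that
    [hh] and A [QS] have the same determinant. Finally
    hh_la is 2^l(la) h_la plus terms with more parts, and [h] = [S]^T [S] has
    determinant 1. Hence det A ^ 2 = \prod_la 2^(l(la) - l(la^r)), where
    l(la) - l(la^r) = 2 l(la^d); a Glaisher bijection turns the sum of the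
    l(la^d) into the two expressions of k_n.
    Both Cauchy identities come from the same argument: the matrix of the
    products of generators (h or q) is symmetric, these products are
    unitriangular in the basis, and the leading monomials of the basis are
    known. *)

(** * Truncated generating series *)

(** Only the square of det A is accessible: the Cauchy identities make [hh] quadratic in [QS], and
    det [QS] is never computed by itself; hence the absolute value. In n variables distinct
    partitions of n give distinct monomials, as they have at most n parts; the doubled Schur
    functions are treated in 2n variables before these are identified in pairs. The main obstacle is
    Q. At t = -1 it is a sum of fractions, in which neither its being a polynomial nor its relation
    to the q_r is visible. Singling out the variable that carries the largest part gives a recursion
    whose one-part case is the partial fraction decomposition of prod (1 + x_i t) / (1 - x_i t). It
    writes Q_mu as q_mu plus multiples of products q_s with s lexicographically larger. Since q_r^2
    is a combination of the q_a q_(2r-a) with a different from r, only strict partitions index basis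
    elements, so the common argument for the Cauchy identities must allow redundant products of
    generators. *)

Section Truncation.
Variable S : comNzRingType.
Implicit Types p q : {poly S}.

Definition eq_upto d p q := forall i, (i <= d)%N -> p`_i = q`_i.

Lemma eq_uptoM d p p' q q' :
  eq_upto d p p' -> eq_upto d q q' -> eq_upto d (p * q) (p' * q').
Proof.
move=> ep eq i le_id; rewrite !coefM; apply: eq_bigr => j _.
by rewrite ep ?eq // (leq_trans _ le_id) // ?leq_subr // -ltnS.
Qed.

Lemma eq_upto_prod (I : Type) (r : seq I) (P : pred I) d (F G : I -> {poly S}) :
  (forall i, P i -> eq_upto d (F i) (G i)) ->
  eq_upto d (\prod_(i <- r | P i) F i) (\prod_(i <- r | P i) G i).
Proof. by move=> eFG; elim/big_ind2: _ => // *; apply: eq_uptoM. Qed.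

End Truncation.

(** * Coefficients of a product of one series over several variables *)

Section SymmetricSeries.
Variables (S : comNzRingType) (I : finType).
Implicit Types (phi psi : nat -> int) (x : I -> S) (A : {set I}).

Definition ser phi d (u : S) : {poly S} :=
  \poly_(a < d.+1) ((phi a)%:~R * u ^+ a).

(* Truncating the factors at degree r does not affect the coefficient of t^r
   of the product of the series phi(x_i t). *)
Definition gen phi x A r : S := (\prod_(i in A) ser phi r (x i))`_r.

Lemma coef_ser phi d u a :
  (ser phi d u)`_a = if (a <= d)%N then (phi a)%:~R * u ^+ a else 0.
Proof. by rewrite coef_poly ltnS. Qed.

Lemma ser_upto phi d e u : (d <= e)%N -> eq_upto d (ser phi e u) (ser phi d u).
Proof.
by move=> le_de i le_id; rewrite !coef_ser le_id (leq_trans le_id le_de).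
Qed.

Lemma gen_wide phi x A r d : (r <= d)%N ->
  gen phi x A r = (\prod_(i in A) ser phi d (x i))`_r.
Proof.
move=> le_rd; have eP : eq_upto r (\prod_(i in A) ser phi d (x i))
    (\prod_(i in A) ser phi r (x i)).
  by apply: eq_upto_prod => i _; apply: ser_upto.
by rewrite eP.
Qed.

Lemma gen_set0 phi x r : gen phi x set0 r = (r == 0)%N%:R.
Proof. by rewrite /gen big_set0 coef1. Qed.

Lemma gen_D1 phi x A i r : i \in A ->
  gen phi x A r =
  \sum_(a < r.+1) (phi a)%:~R * x i ^+ a * gen phi x (A :\ i) (r - a).
Proof.
move=> Ai; rewrite /gen (big_setD1 i) //= coefM; apply: eq_bigr => a _.
by rewrite coef_ser -ltnS ltn_ord -(gen_wide _ _ _ (leq_subr a r)).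
Qed.

Definition convolution phi psi k := \sum_(a < k.+1) phi a * psi (k - a)%N.

Lemma ser_mul phi psi chi d u : chi =1 convolution phi psi ->
  eq_upto d (ser phi d u * ser psi d u) (ser chi d u).
Proof.
move=> chiE k le_kd; rewrite coef_ser le_kd coefM chiE rmorph_sum mulr_suml.
apply: eq_bigr => a _; have le_ak : (a <= k)%N by rewrite -ltnS.
rewrite !coef_ser (leq_trans le_ak) // (leq_trans (leq_subr _ _) le_kd).
by rewrite rmorphM /= mulrACA -exprD subnKC.
Qed.

Lemma ser_delta d u : eq_upto d (ser (fun k => (k == 0)%N%:R) d u) 1.
Proof.
move=> [|k] le_kd; rewrite coef_ser le_kd coef1 /= ?mulr1 //.
by rewrite mul0r.
Qed.

Lemma gen_mul phi psi chi x A r : chi =1 convolution phi psi ->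
  gen chi x A r = \sum_(a < r.+1) gen phi x A a * gen psi x A (r - a).
Proof.
move=> chiE; have eP : eq_upto r (\prod_(i in A) ser chi r (x i))
    (\prod_(i in A) ser phi r (x i) * \prod_(i in A) ser psi r (x i)).
  rewrite -big_split /=; apply: eq_upto_prod => i _ k le_kr.
  by rewrite (ser_mul _ chiE).
rewrite [LHS]eP // coefM; apply: eq_bigr => a _.
by rewrite -!gen_wide ?leq_subr // -ltnS.
Qed.

Lemma gen_delta x A r : gen (fun k => (k == 0)%N%:R) x A r = (r == 0)%N%:R.
Proof.
have eP : eq_upto r (\prod_(i in A) ser (fun k => (k == 0)%N%:R) r (x i)) 1.
  rewrite [X in eq_upto _ _ X](_ : 1 = \prod_(i in A) 1); last by rewrite big1_eq.
  by apply: eq_upto_prod => i _; apply: ser_delta.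
by rewrite [LHS]eP // coef1.
Qed.

(* \prod_(j in A) phi(x_j) * \prod_(j in A :\ i) phi(x_j)^-1 = phi(x_i) *)
Lemma gen_D1_single phi psi x A i r : i \in A ->
    (fun k => (k == 0)%N%:R) =1 convolution phi psi ->
  \sum_(a < r.+1) gen phi x A a * gen psi x (A :\ i) (r - a) =
  (phi r)%:~R * x i ^+ r.
Proof.
move=> Ai deltaE.
have eP : eq_upto r (ser phi r (x i) *
    (\prod_(j in A :\ i) ser phi r (x j) *
     \prod_(j in A :\ i) ser psi r (x j))) (ser phi r (x i)).
  rewrite -[X in eq_upto _ _ X]mulr1; apply: eq_uptoM => //.
  rewrite [X in eq_upto _ _ X](_ : 1 = \prod_(j in A :\ i) 1); last first.
    by rewrite big1_eq.
  rewrite -big_split; apply: eq_upto_prod => j _ k le_kr.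
  by rewrite (ser_mul _ deltaE) // ser_delta.
move/(_ r (leqnn r)): eP; rewrite mulrA -big_setD1 //= coef_ser leqnn => <-.
rewrite coefM; apply: eq_bigr => a _.
by rewrite -!gen_wide ?leq_subr // -ltnS.
Qed.

(* \prod_(j in A :\ i) phi(x_j) = phi(x_i)^-1 * \prod_(j in A) phi(x_j) *)
Lemma gen_D1_inv phi psi x A i r : i \in A ->
    (fun k => (k == 0)%N%:R) =1 convolution psi phi ->
  gen phi x (A :\ i) r =
  \sum_(a < r.+1) (psi a)%:~R * x i ^+ a * gen phi x A (r - a).
Proof.
move=> Ai deltaE.
have eP : eq_upto r ((ser psi r (x i) * ser phi r (x i)) *
    \prod_(j in A :\ i) ser phi r (x j)) (\prod_(j in A :\ i) ser phi r (x j)).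
  rewrite -[X in eq_upto _ _ X]mul1r; apply: eq_uptoM => // k le_kr.
  by rewrite (ser_mul _ deltaE) // ser_delta.
move/(_ r (leqnn r)): eP; rewrite -mulrA -big_setD1 //= /gen => <-.
rewrite coefM; apply: eq_bigr => a _; rewrite coef_ser -ltnS ltn_ord.
by rewrite -!gen_wide ?leq_subr.
Qed.

Lemma gen_0 phi x A : phi 0%N = 1 -> gen phi x A 0 = 1.
Proof.
move=> phi0; rewrite /gen -horner_coef0 horner_prod big1 // => i _.
by rewrite horner_coef0 coef_ser phi0 mulr1.
Qed.

Lemma eq_gen phi psi x y A r : phi =1 psi -> x =1 y ->
  gen phi x A r = gen psi y A r.
Proof.
move=> ephi ex; rewrite /gen (eq_bigr (fun i => ser psi r (y i))) // => i _.
by apply/polyP=> a; rewrite !coef_ser ephi ex.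
Qed.

Lemma gen_expand phi x r d : (r <= d)%N ->
  gen phi x setT r = \sum_(m : {ffun I -> 'I_d.+1} | (\sum_i m i == r)%N)
    (\prod_i ((phi (m i))%:~R * x i ^+ m i)).
Proof.
move=> le_rd; rewrite (gen_wide _ _ _ le_rd).
under eq_bigr do rewrite /ser poly_def.
under eq_bigl do rewrite inE.
rewrite bigA_distr_bigA coef_sum [RHS]big_mkcond; apply: eq_bigr => m _.
rewrite scaler_prod prodrXr coefZ coefXn eq_sym.
by case: eqP; rewrite ?mulr1 ?mulr0.
Qed.

End SymmetricSeries.

Lemma rmorph_gen (S T : comNzRingType) (f : {rmorphism S -> T}) (I : finType)
    phi (x : I -> S) A r :
  f (gen phi x A r) = gen phi (f \o x) A r.
Proof.
rewrite /gen -coef_map rmorph_prod (eq_bigr (fun i => ser phi r (f (x i)))) //.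
move=> i _; apply/polyP=> a; rewrite coef_map !coef_ser.
case: leqP => _ /=; last exact: rmorph0.
by rewrite /= rmorphM rmorph_int rmorphXn.
Qed.

(** * Symmetry of the coefficient matrix, by contingency tables *)

Section Contingency.
Variables (R : idomainType) (N : nat).
Implicit Types (phi : nat -> int) (alpha beta : 'X_{1..N}).

Definition genX phi r : {mpoly R[N]} :=
  gen phi (fun i : 'I_N => 'X_i : {mpoly R[N]}) setT r.

(** One definition for three families: with [phi_h], [phi_q] and [phi_hh] below it gives h_s, q_s
    and h_s(x, x). *)
Definition genXs phi (s : seq nat) : {mpoly R[N]} := \prod_(r <- s) genX phi r.

(** Choosing a monomial of degree alpha_i in the i-th factor is choosing the i-th row of a matrix;
    the column sums are then the exponents of the product. *)
Lemma mcoeff_genXs phi d alpha beta : (forall i, alpha i <= d)%N ->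
  (genXs phi alpha)@_beta =
  \sum_(A : {ffun 'I_N -> {ffun 'I_N -> 'I_d.+1}} |
        [forall i, \sum_j A i j == alpha i]%N &&
        [forall j, \sum_i A i j == beta j]%N)
    \prod_i \prod_j (phi (A i j))%:~R.
Proof.
move=> le_d; rewrite /genXs big_tuple.
under eq_bigr => i _ do
  rewrite -mnm_tnth /genX (gen_expand _ _ (le_d i)) big_mkcond.
rewrite bigA_distr_bigA raddf_sum [RHS]big_mkcond; apply: eq_bigr => A _ /=.
case: (boolP [forall i, _]) => [/forallP row | /forallPn[i row]]; last first.
  by rewrite (bigD1 i) //= (negPf row) mul0r mcoeff0.
under eq_bigr do rewrite row big_split.
rewrite big_split /= [X in _ * X]exchange_big /=.
have -> : \prod_j \prod_i ('X_j : {mpoly R[N]}) ^+ A i j =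
    'X_[[multinom \sum_i A i j | j < N]]%N.
  by rewrite mpolyXE_id; apply: eq_bigr => j _; rewrite prodrXr mnmE.
have -> : \prod_i \prod_j ((phi (A i j))%:~R : {mpoly R[N]}) =
    (\prod_i \prod_j (phi (A i j))%:~R)%:MP.
  rewrite rmorph_prod; apply: eq_bigr => i _; rewrite rmorph_prod.
  by apply: eq_bigr => j _; rewrite rmorph_int.
rewrite mcoeffCM mcoeffX.
have -> : [forall j, \sum_i A i j == beta j]%N =
    ([multinom (\sum_i A i j)%N | j < N] == beta).
  apply/forallP/eqP => [col | <- j]; last by rewrite mnmE.
  by apply/mnmP=> j; rewrite mnmE; apply/eqP.
by case: eqP; rewrite ?mulr1 ?mulr0.
Qed.

(** Transposing a table exchanges its row and column sums and preserves its weight. *)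
Lemma genXs_sym phi alpha beta :
  (genXs phi alpha)@_beta = (genXs phi beta)@_alpha.
Proof.
(* A bound for both exponents, so that a table and its transpose live in the same finite type. *)
pose d := (\sum_i alpha i + \sum_i beta i)%N.
have le_a i : (alpha i <= d)%N by rewrite /d (bigD1 i) //= -!addnA leq_addr.
have le_b i : (beta i <= d)%N by rewrite /d addnC (bigD1 i) //= -!addnA leq_addr.
rewrite (mcoeff_genXs _ _ le_a) (mcoeff_genXs _ _ le_b).
pose tr (A : {ffun 'I_N -> {ffun 'I_N -> 'I_d.+1}}) :=
  [ffun i => [ffun j => A j i]].
have trK : involutive tr.
  by move=> A; apply/ffunP=> i; apply/ffunP=> j; rewrite !ffunE.
rewrite (reindex_inj (inv_inj trK)); apply: eq_big => [A | A _].
  rewrite andbC; congr (_ && _); apply: eq_forallb => i; congr (_ == _);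
    by apply: eq_bigr => j _; rewrite !ffunE.
rewrite exchange_big; apply: eq_bigr => i _; apply: eq_bigr => j _.
by rewrite !ffunE.
Qed.

End Contingency.

(** * Partitions and the lexicographic order *)

Section Partitions.
Local Open Scope nat_scope.
Implicit Types s t u : seq nat.

Lemma geq_trans : transitive geq.
Proof. by move=> a b c /= le_ba le_ac; apply: leq_trans le_ac le_ba. Qed.

Lemma geq_anti : antisymmetric geq.
Proof. by move=> a b; rewrite /= andbC; apply: anti_leq. Qed.

Lemma geq_total : total geq.
Proof. by move=> a b; apply: leq_total. Qed.

Lemma geq_refl : reflexive geq.
Proof. by move=> a /=. Qed.

Definition normalize s := sort geq [seq r <- s | 0 < r].

Lemma mem_leq_sumn s r : r \in s -> r <= sumn s.
Proof.
elim: s => //= a s IHs; rewrite inE => /predU1P[-> | /IHs le_rs].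
  exact: leq_addr.
exact: leq_trans le_rs (leq_addl _ _).
Qed.

Lemma size_leq_sumn s : 0 \notin s -> size s <= sumn s.
Proof.
elim: s => //= a s IHs; rewrite inE negb_or eq_sym -lt0n => /andP[a_gt0 /IHs].
by rewrite -add1n; apply: leq_add.
Qed.

Lemma exists_intpart k s : is_part s -> sumn s = k ->
  exists la : intpart k, la = s :> seq nat.
Proof.
move=> s_part sumn_s.
pose t := [seq inord r : 'I_k.+1 | r <- s].
have tK : [seq nat_of_ord i | i <- t] = s.
  rewrite -map_comp map_id_in // => r s_r /=.
  by rewrite inordK // ltnS -sumn_s mem_leq_sumn.
have size_t : size t <= k.
  by rewrite size_map -sumn_s size_leq_sumn //; case/andP: s_part.
have t_part : is_part [seq nat_of_ord i | i <- Bseq size_t] &&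
    (sumn [seq nat_of_ord i | i <- Bseq size_t] == k).
  by rewrite /= tK s_part sumn_s eqxx.
by exists (IntPart t_part); rewrite /parts /= tK.
Qed.

Lemma intpart_is_part k (la : intpart k) : is_part la.
Proof. by case: la => b bP; have /andP[] := bP. Qed.

Lemma sumn_intpart k (la : intpart k) : sumn la = k.
Proof. by case: la => b bP; have /andP[_ /eqP] := bP. Qed.

Lemma intpart_inj k : injective (@parts k).
Proof.
move=> la ka eq_p; apply/val_inj/val_inj => /=.
by apply: (inj_map val_inj); apply: eq_p.
Qed.

Lemma size_intpart k (la : intpart k) : size la <= k.
Proof.
rewrite -[X in _ <= X](sumn_intpart la) size_leq_sumn //.
by case/andP: (intpart_is_part la).
Qed.

Lemma normalize_is_part s : is_part (normalize s).
Proof.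
apply/andP; split; first exact/sort_sorted/geq_total.
by rewrite mem_sort mem_filter.
Qed.

Lemma sumn_normalize s : sumn (normalize s) = sumn s.
Proof.
have /perm_sumn -> : perm_eq (normalize s) [seq r <- s | 0 < r].
  by rewrite perm_sort.
by elim: s => //= -[|a] s /= ->.
Qed.

Lemma normalize_id s : is_part s -> normalize s = s.
Proof.
case/andP=> s_sorted s0; rewrite /normalize (_ : filter _ s = s).
  exact/sorted_sort/s_sorted/geq_trans.
by apply/all_filterP/allP=> r s_r; rewrite lt0n; apply: contraNneq s0 => <-.
Qed.

Lemma nth0_normalize s r : r \in s -> r <= nth 0 (normalize s) 0.
Proof.
case: (posnP r) => [-> // | r_gt0 s_r].
have: r \in normalize s by rewrite mem_sort mem_filter r_gt0.
have := normalize_is_part s; case: (normalize s) => //= b t /andP[ + _].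
rewrite /= (path_sortedE geq_trans) => /andP[/allP le_b _].
by rewrite inE => /predU1P[-> // | /le_b].
Qed.

Lemma normalize_cons_max a s : 0 < a -> {in s, forall r, r <= a} ->
  normalize (a :: s) = a :: normalize s.
Proof.
move=> a_gt0 le_a; apply: (sorted_eq geq_trans geq_anti).
- exact/sort_sorted/geq_total.
- rewrite /= (path_sortedE geq_trans); apply/andP; split.
    by apply/allP=> r; rewrite mem_sort mem_filter => /andP[_ /le_a].
  exact/sort_sorted/geq_total.
by rewrite /normalize /= a_gt0 perm_sort perm_cons perm_sym perm_sort.
Qed.

(** Lexicographic order of sequences padded by zeros; in equal degree it is the order of the
    monomials of [mpoly]. *)
Definition lexlt s t :=
  exists2 i, (forall j, j < i -> nth 0 s j = nth 0 t j) & nth 0 s i < nth 0 t i.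

(** Either the first entry is a maximum and stays in front, or a larger one takes its place.
    Equality is stated entrywise because [normalize] drops zeros. *)
Lemma normalize_ge s :
  (forall i, nth 0 s i = nth 0 (normalize s) i) \/ lexlt s (normalize s).
Proof.
elim: s => [|a s IHs]; first by left.
have [/allP le_a | /allPn[b s_b]] := boolP (all (leq^~ a) s); last first.
  rewrite -ltnNge => lt_ab; right; exists 0 => //=.
  by rewrite (leq_trans lt_ab) // nth0_normalize // inE s_b orbT.
have [a0 | a_gt0] := posnP a.
  left=> i; have s0 : all (pred1 0) (a :: s).
    rewrite /= a0 /=; apply/allP=> r /le_a; rewrite a0 leqn0.
    by move/eqP->.
  have /all_pred1P sE := s0.
  rewrite /normalize (_ : filter _ _ = [::]); last first.
    by rewrite sE; elim: (size _).
  by rewrite {1}sE nth_nseq nth_nil; case: ifP.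
rewrite normalize_cons_max //; case: IHs => [eq_s | [i eq_i lt_i]].
  by left=> -[|i] /=.
by right; exists i.+1 => // -[|j] //=; rewrite ltnS; apply: eq_i.
Qed.

Lemma lexlt_cat u a b s t : a < b -> lexlt (u ++ a :: s) (u ++ b :: t).
Proof.
move=> lt_ab; exists (size u) => [j lt_j|].
  by rewrite !nth_cat lt_j.
by rewrite !nth_cat ltnn subnn.
Qed.

End Partitions.

Section Monomials.
Variable N : nat.
Implicit Types s t : seq nat.

Definition mnp s : 'X_{1..N} := [multinom nth 0%N s i | i < N].

Lemma mdeg_mnp s : (size s <= N)%N -> mdeg (mnp s) = sumn s.
Proof.
move=> le_sN; rewrite mdegE; under eq_bigr do rewrite mnmE.
rewrite sumnE (big_nth 0%N) big_mkord (big_ord_widen N (nth 0%N s)) //.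
rewrite [RHS]big_mkcond; apply: eq_bigr => i _.
by case: ltnP => // /(nth_default 0%N).
Qed.

Lemma mnp_lt s t : (size s <= N)%N -> (size t <= N)%N -> sumn s = sumn t ->
  lexlt s t -> (mnp s < mnp t)%O.
Proof.
move=> le_s le_t eq_st [i eq_i lt_i]; apply/ltmcP; first by rewrite !mdeg_mnp.
have lt_iN : (i < N)%N.
  rewrite ltnNge; apply/negP => le_Ni; move: lt_i.
  by rewrite [X in (_ < X)%N]nth_default // (leq_trans le_t).
exists (Ordinal lt_iN) => [j lt_ji|]; first by rewrite !mnmE eq_i.
by rewrite !mnmE.
Qed.

Lemma size_normalize s : (size (normalize s) <= size s)%N.
Proof. by rewrite size_sort size_filter count_size. Qed.

Lemma mnp_normalize s : (size s <= N)%N -> (mnp s <= mnp (normalize s))%O.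
Proof.
move=> le_sN; case: (normalize_ge s) => [eq_s | lt_s].
  by rewrite (_ : mnp s = mnp (normalize s)) //; apply/mnmP=> i; rewrite !mnmE.
apply/ltW/mnp_lt => //; first exact: leq_trans (size_normalize s) le_sN.
by rewrite sumn_normalize.
Qed.

(** The expansions below produce unsorted index sequences; sorting them can only raise them
    further. *)
Lemma mnp_lt_normalize s t :
    (size s <= N)%N -> (size t <= N)%N -> sumn s = sumn t ->
  lexlt s t -> (mnp s < mnp (normalize t))%O.
Proof.
by move=> ? le_t ? lt_st; apply: lt_le_trans (mnp_normalize le_t); apply: mnp_lt.
Qed.

Lemma normalize_mnp s : (size s <= N)%N -> normalize (mnp s) = normalize s.
Proof.
move=> le_sN; have -> : mnp s = s ++ nseq (N - size s) 0%N :> seq nat.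
  apply: (eq_from_nth (x0 := 0%N)) => [|i].
    by rewrite size_tuple size_cat size_nseq subnKC.
  rewrite size_tuple => lt_iN; rewrite -(mnm_nth 0%N (mnp s) (Ordinal lt_iN)).
  rewrite mnmE nth_cat nth_nseq; case: ltnP => // /(nth_default 0%N)->.
  by case: ifP.
rewrite /normalize filter_cat (_ : [seq r <- nseq _ _ | _] = [::]) ?cats0 //.
by elim: (N - _)%N.
Qed.

Lemma mnp_inj k : (k <= N)%N -> injective (fun la : intpart k => mnp la).
Proof.
move=> le_kN la ka eq_m; apply: intpart_inj.
have eq_nth i : nth 0%N la i = nth 0%N ka i.
  case: (ltnP i N) => [lt_iN | le_Ni].
    by have /mnmP/(_ (Ordinal lt_iN)) := eq_m; rewrite !mnmE.
  by rewrite !nth_default // (leq_trans (size_intpart _)) // (leq_trans le_kN).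
have part_nth0 (mu : intpart k) i : (i < size mu)%N -> (0 < nth 0%N mu i)%N.
  move=> lt_i; have /andP[_] := intpart_is_part mu.
  by rewrite lt0n; apply: contraNneq => <-; apply: mem_nth.
apply: (eq_from_nth (x0 := 0%N)) => //; apply/eqP; rewrite eqn_leq.
apply/andP; split; rewrite leqNgt; apply/negP => /part_nth0.
  by rewrite eq_nth nth_default.
by rewrite -eq_nth nth_default.
Qed.

End Monomials.

(** * Spans of subfamilies *)

Section Span.
Variables (R : pzRingType) (V : lmodType R) (I : finType) (b : I -> V).
Implicit Types (P Q : pred I) (v w : V).

Definition inspan P v := exists c : I -> R, v = \sum_(i | P i) c i *: b i.

Lemma inspan0 P : inspan P 0.
Proof. by exists (fun=> 0); rewrite big1 // => i _; rewrite scale0r. Qed.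

Lemma inspanD P v w : inspan P v -> inspan P w -> inspan P (v + w).
Proof.
move=> [c ->] [d ->]; exists (fun i => c i + d i).
by rewrite -big_split; apply: eq_bigr => i _; rewrite scalerDl.
Qed.

Lemma inspanZ P a v : inspan P v -> inspan P (a *: v).
Proof.
move=> [c ->]; exists (fun i => a * c i).
by rewrite scaler_sumr; apply: eq_bigr => i _; rewrite scalerA.
Qed.

Lemma inspanN P v : inspan P v -> inspan P (- v).
Proof. by move=> Pv; rewrite -scaleN1r; apply: inspanZ. Qed.

Lemma inspan_sum P (J : eqType) (r : seq J) (Q : pred J) (F : J -> V) :
  (forall j, j \in r -> Q j -> inspan P (F j)) ->
  inspan P (\sum_(j <- r | Q j) F j).
Proof.
move=> PF; rewrite big_seq_cond; elim/big_rec: _ => [|j v]; first exact: inspan0.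
by case/andP=> r_j Q_j Pv; apply: inspanD => //; apply: PF.
Qed.

Lemma inspan_mem P i : P i -> inspan P (b i).
Proof.
move=> Pi; exists (fun j => (j == i)%:R); rewrite (bigD1 i) //= eqxx scale1r.
by rewrite big1 ?addr0 // => j /andP[_ /negPf->]; rewrite scale0r.
Qed.

(** The target is any predicate stable under linear combinations, so that it can be a span over
    another family. *)
Lemma inspan_trans P v (W : V -> Prop) :
    W 0 -> (forall v w, W v -> W w -> W (v + w)) ->
    (forall a v, W v -> W (a *: v)) -> (forall i, P i -> W (b i)) ->
  inspan P v -> W v.
Proof.
move=> W0 WD WZ Wb [c ->]; elim/big_rec: _ => // i w Pi Ww.
by apply: WD => //; apply/WZ/Wb.
Qed.

Lemma inspan_sub P Q v : subpred P Q -> inspan P v -> inspan Q v.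
Proof.
move=> sPQ; apply: inspan_trans.
- exact: inspan0.
- exact: inspanD.
- exact: inspanZ.
by move=> i /sPQ Qi; apply: inspan_mem.
Qed.

End Span.

Section GenSpan.
Variables (R : idomainType) (N k : nat) (phi : nat -> int).
Hypothesis phi0 : phi 0%N = 1.
Implicit Types (P Q : pred (intpart k)) (s : seq nat).

Lemma genXs_normalize s : genXs R N phi (normalize s) = genXs R N phi s.
Proof.
rewrite /genXs (perm_big [seq r <- s | (0 < r)%N]) /=; last first.
  by apply/permPl/perm_sort.
rewrite big_filter big_mkcond; apply: eq_bigr => r _.
by case: posnP => // ->; rewrite [RHS]gen_0.
Qed.

Lemma genXs_mnp s : (size s <= N)%N -> genXs R N phi (mnp N s) = genXs R N phi s.
Proof.
move=> le_sN; rewrite /genXs big_tuple (big_nth 0%N) big_mkord.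
rewrite (big_ord_widen N (fun i => genX R N phi (nth 0%N s i))) //.
rewrite [RHS]big_mkcond; apply: eq_bigr => i _; rewrite -mnm_tnth mnmE.
by case: ltnP => // /(nth_default 0%N) ->; rewrite [LHS]gen_0.
Qed.

Definition genP (ka : intpart k) : {mpoly R[N]} := genXs R N phi ka.

Lemma inspan_genXs P s : sumn s = k ->
    (forall ka : intpart k, ka = normalize s :> seq nat -> P ka) ->
  inspan genP P (genXs R N phi s).
Proof.
move=> sumn_s P_s.
have sumn_ns : sumn (normalize s) = k by rewrite sumn_normalize.
have [ka kaE] := exists_intpart (normalize_is_part s) sumn_ns.
by rewrite -genXs_normalize -kaE; apply: (inspan_mem genP); apply: P_s.
Qed.

End GenSpan.

(** * Cauchy identities from triangularity *)

Section Cauchy.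
Variables (F : fieldType) (N k : nat) (phi : nat -> int).
Hypotheses (phi0 : phi 0%N = 1) (le_kN : (k <= N)%N).
Variables (St : pred (intpart k)) (B : intpart k -> {mpoly F[N]}).
Variable d : intpart k -> F.

Local Notation "la <l ka" :=
  (mnp N (la : intpart k) < mnp N (ka : intpart k))%O (at level 70, only parsing).
Local Notation g := (genP F N phi (k:=k)).

(** Outside [St] a product of generators is redundant, being a combination of larger ones. [St] will
    be everything for h and the strict partitions for q. *)
Hypothesis genE : forall la,
  inspan g (fun nu => la <l nu) (g la - (if St la then B la else 0)).
Hypothesis B_gt : forall mu la, St mu -> mu <l la -> (B mu)@_(mnp N la) = 0.
Hypothesis B_eq : forall mu, St mu -> (B mu)@_(mnp N mu) = d mu.
Hypothesis d_neq0 : forall mu, St mu -> d mu != 0.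

Lemma intpart_ind_gt (P : intpart k -> Prop) :
  (forall la, (forall ka, la <l ka -> P ka) -> P la) -> forall la, P la.
Proof.
move=> IH la; pose rk la := #|[pred ka : intpart k | la <l ka]|.
have [m] := ubnP (rk la); elim: m la => // m IHm la lt_m.
apply: IH => ka lt_ka; apply: IHm; rewrite ltnS in lt_m.
apply: leq_trans lt_m; apply: proper_card; apply/properP; split.
  by apply/subsetP=> nu; rewrite !inE; apply: lt_trans.
by exists ka; rewrite !inE ?ltxx.
Qed.

Lemma gen_in_basis la :
  inspan B (fun mu => St mu && (la <l mu)) (g la - (if St la then B la else 0)).
Proof.
elim/intpart_ind_gt: la => la IH; apply: inspan_trans (genE la).
- exact: inspan0.
- exact: inspanD.
- exact: inspanZ.
move=> nu lt_nu; rewrite -[g nu](subrK (if St nu then B nu else 0)).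
apply: inspanD; first apply: inspan_sub (IH nu lt_nu) => mu /andP[-> lt_mu].
  exact: lt_trans lt_nu lt_mu.
case: ifP => St_nu; last exact: inspan0.
by apply: (inspan_mem B); rewrite St_nu.
Qed.

(** By [genXs_sym] the coefficient of x^alpha in g_mu is that of x^mu in g_alpha, and g_alpha
    depends only on the nonzero entries of alpha up to order. *)
Lemma gen_sym_alpha mu (alpha beta : 'X_{1..N}) : 
    normalize alpha = normalize beta ->
  (g mu)@_alpha = (g mu)@_beta.
Proof.
have le_mu : (size mu <= N)%N := leq_trans (size_intpart mu) le_kN.
move=> eq_ab; rewrite /genP -(genXs_mnp _ phi0 le_mu).
rewrite genXs_sym [RHS]genXs_sym.
by rewrite -genXs_normalize // eq_ab genXs_normalize.
Qed.

Lemma basis_in_gen mu : St mu -> inspan g predT (B mu).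
Proof.
move=> St_mu; rewrite -[B mu](subKr (g mu)); apply: inspanD.
  exact: (@inspan_mem _ _ _ g predT).
by apply: inspanN; have := genE mu; rewrite St_mu; apply: inspan_sub.
Qed.

(** Expand g_la = sum of [Z la mu] B_mu with Z unitriangular. The symmetry of the coefficients of g,
    together with the leading terms of the B_mu, forces the coefficients of B_mu to be [d mu] times
    the column of Z at mu. *)
Lemma cauchy_intpart la :
  g la = \sum_(mu | St mu) ((d mu)^-1 * (B mu)@_(mnp N la)) *: B mu.
Proof.
have [c cE] : exists c : intpart k -> intpart k -> F, forall la,
    g la - (if St la then B la else 0) =
    \sum_(mu | St mu && (la <l mu)) c la mu *: B mu.
  exact: (@fin_all_exists _ (fun=> intpart k -> F) _ gen_in_basis).
pose Z la mu := (la == mu)%:R + (if la <l mu then c la mu else 0).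
have gZ ka : g ka = \sum_(mu | St mu) Z ka mu *: B mu.
  rewrite -[LHS](subrK (if St ka then B ka else 0)) cE big_mkcondr /= addrC.
  under [RHS]eq_bigr do rewrite scalerDl; rewrite big_split /=; congr (_ + _).
    case: ifP => St_ka.
      rewrite (bigD1 ka) //= eqxx scale1r big1 ?addr0 // => mu /andP[_].
      by rewrite eq_sym => /negPf->; rewrite scale0r.
    rewrite big1 // => mu St_mu; rewrite (_ : ka == mu = false) ?scale0r //.
    by apply: contraFF St_ka => /eqP->.
  by apply: eq_bigr => mu _; case: ifP => _; rewrite ?scale0r.
have Z_id mu : Z mu mu = 1 by rewrite /Z eqxx ltxx addr0.
have Z_lt ka mu : mu <l ka -> Z ka mu = 0.
  move=> lt_mu; rewrite /Z (lt_gtF lt_mu) addr0.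
  by case: eqP lt_mu => // ->; rewrite ltxx.
have symg (ka nu : intpart k) : (g ka)@_(mnp N nu) = (g nu)@_(mnp N ka).
  have le_N (mu : intpart k) : (size mu <= N)%N :=
    leq_trans (size_intpart mu) le_kN.
  by rewrite /genP -(genXs_mnp _ phi0 (le_N ka)) genXs_sym genXs_mnp.
have trich (ka nu : intpart k) : [|| ka <l nu, nu <l ka | ka == nu].
  case: (ltgtP (mnp N ka) (mnp N nu)) => //.
  by move/(mnp_inj le_kN)->; rewrite eqxx.
(* Descending induction on mu. In the symmetry relation between ka and mu, the terms nu > mu agree
   on both sides by induction and the terms nu < mu vanish on both sides, which isolates nu = mu. *)
have BZ (ka mu : intpart k) : St mu -> (B mu)@_(mnp N ka) = d mu * Z ka mu.
  elim/intpart_ind_gt: mu ka => mu IH ka St_mu.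
  have := symg ka mu; rewrite !gZ !raddf_sum /=.
  under eq_bigr do rewrite mcoeffZ; under [RHS]eq_bigr do rewrite mcoeffZ.
  rewrite (bigD1 mu) //= B_eq // [RHS](bigD1 mu) //= Z_id mul1r mulrC.
  suff -> : \sum_(i | St i && (i != mu)) Z ka i * (B i)@_(mnp N mu) =
    \sum_(i | St i && (i != mu)) Z mu i * (B i)@_(mnp N ka) by move/addIr->.
  apply: eq_bigr => nu /andP[St_nu nu_neq].
  have /or3P[lt|lt|/eqP eq] := trich mu nu; last by rewrite eq eqxx in nu_neq.
    by rewrite !(IH nu) // mulrCA [RHS]mulrCA [Z ka nu * _]mulrC.
  by rewrite (Z_lt mu nu) // B_gt // mulr0 mul0r.
rewrite gZ; apply: eq_bigr => mu St_mu; rewrite BZ // mulKf //; exact: d_neq0.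
Qed.

(** Both sides depend only on the sorted alpha: each B_mu is a combination of the g, to which
    [gen_sym_alpha] applies. *)
Lemma cauchy (alpha : 'X_{1..N}) : mdeg alpha = k ->
  genXs F N phi alpha = \sum_(mu | St mu) ((d mu)^-1 * (B mu)@_alpha) *: B mu.
Proof.
rewrite /mdeg -sumnE => sumn_a.
have sumn_na : sumn (normalize alpha) = k by rewrite sumn_normalize.
have [la laE] := exists_intpart (normalize_is_part alpha) sumn_na.
have le_la : (size la <= N)%N := leq_trans (size_intpart la) le_kN.
rewrite -genXs_normalize // -laE [LHS](cauchy_intpart la).
apply: eq_bigr => mu St_mu; congr ((_ * _) *: _).
have [c ->] := basis_in_gen St_mu; rewrite !raddf_sum; apply: eq_bigr => ka _ /=.
rewrite !mcoeffZ (@gen_sym_alpha _ (mnp N la) alpha) //.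
by rewrite normalize_mnp // laE (normalize_id (normalize_is_part _)).
Qed.

End Cauchy.

(** * Schur polynomials *)

(* The coefficients of 1 / (1 - u), 1 - u, and 1 / (1 - u)^2. *)
Definition phi_h (k : nat) : int := 1.
Definition phi_e (k : nat) : int := (k == 0)%N%:R - (k == 1)%N%:R.
Definition phi_hh (k : nat) : int := k.+1%:R.

Lemma phi_h_inv : (fun k => (k == 0)%N%:R) =1 convolution phi_h phi_e.
Proof.
case=> [|k]; rewrite /convolution; first by rewrite big_ord1.
rewrite !big_ord_recr /= subnn subSnn big1 ?add0r // => a _.
by rewrite subSn 1?ltnW // -[(k - a)%N]prednK // subn_gt0.
Qed.

Lemma phi_hh_h : phi_hh =1 convolution phi_h phi_h.
Proof.
by move=> k; rewrite /convolution sumr_const card_ord.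
Qed.

(** These are the signed elementary polynomials, of degree at most one in each variable. *)
Lemma gen_phi_e_gt (S : comNzRingType) (I : finType) (x : I -> S) (A : {set I}) r :
  (#|A| < r)%N -> gen phi_e x A r = 0.
Proof.
have [m] := ubnP #|A|; elim: m => // m IHm in A r *; rewrite ltnS => le_Am lt_Ar.
have [A0 | [i Ai]] := set_0Vmem A.
  by rewrite A0 gen_set0; case: r lt_Ar.
have cA : #|A| = #|A :\ i|.+1 by rewrite (cardsD1 i) Ai.
rewrite cA in le_Am lt_Ar.
rewrite (gen_D1 _ _ _ Ai) big1 // => -[[|[|a]] lt_a] _ /=; last first.
- by rewrite /phi_e /= subr0 !mul0r.
- by rewrite IHm ?mulr0 ?ltn_subRL.
by rewrite IHm ?mulr0 // subn0 ltnW.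
Qed.

(** The first moved point cannot go to a smaller point, since those are fixed. This locates the
    first difference in lexicographic comparisons of permuted exponents. *)
Lemma perm_first N (s : 'S_N) : s != 1%g ->
  exists2 j : 'I_N, (forall i : 'I_N, i < j -> s i = i)%N & (j < s j)%N.
Proof.
move=> s1; have [j0 sj0] : exists j, s j != j.
  apply/existsP; apply: contraNT s1; rewrite negb_exists => /forallP s_id.
  by apply/eqP/permP=> i; rewrite perm1; apply/eqP; rewrite -[_ == _]negbK.
case: (@arg_minnP _ j0 (fun j => s j != j) (@nat_of_ord N) sj0) => j sj min_j.
have s_id (i : 'I_N) : (i < j)%N -> s i = i.
  by move=> lt_ij; apply/eqP; apply: contraTT lt_ij => /min_j; rewrite -leqNgt.
exists j => //; rewrite ltnNge leq_eqVlt; apply/negP => /orP[/eqP/val_inj e|lt_s].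
  by move: sj; rewrite e eqxx.
by have /perm_inj sjj := s_id _ lt_s; move: sj; rewrite sjj eqxx.
Qed.

Lemma mlead_char (R : nzRingType) N (p : {mpoly R[N]}) m :
  p@_m != 0 -> (forall m', (m < m')%O -> p@_m' = 0) -> mlead p = m.
Proof.
rewrite mcoeff_eq0 negbK => p_m p_gt; apply/le_anti.
rewrite (msupp_le_mlead p_m) andbT leNgt; apply/negP => /p_gt/eqP.
rewrite mleadc_eq0 => /eqP p0; by rewrite p0 msupp0 in p_m.
Qed.

Section Schur.
Variables (R : idomainType) (N : nat).

Local Notation X := (fun i : 'I_N => 'X_i : {mpoly R[N]}).
Local Notation h := (genX R N phi_h).
Local Notation delta := (delta N).

Definition hsub m k : {mpoly R[N]} := if (k <= m)%N then h (m - k) else 0.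

(** Multiplying prod_j 1 / (1 - x_j t) by the 1 - x_j t with j different from i leaves 1 / (1 - x_i
    t). The sum stops at N because only N - 1 variables remain in the elementary factor. *)
Lemma Xn_e_h (i : 'I_N) m :
  ('X_i : {mpoly R[N]}) ^+ m =
  \sum_(k < N) gen phi_e X (setT :\ i) (delta k) * hsub m (delta k).
Proof.
have := gen_D1_single X m (in_setT i) phi_h_inv; rewrite mul1r => <-.
have -> : \sum_(k < N) gen phi_e X (setT :\ i) (delta k) * hsub m (delta k) =
    \sum_(k < N) gen phi_e X (setT :\ i) k * hsub m k.
  by rewrite [RHS](reindex_inj rev_ord_inj).
pose F k := gen phi_e X (setT :\ i) k * hsub m k.
have F_gtm k : (m < k)%N -> F k = 0 by move=> lt_mk; rewrite /F /hsub leqNgt lt_mk mulr0.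
have F_geN k : (N <= k)%N -> F k = 0.
  move=> le_Nk; rewrite /F gen_phi_e_gt ?mul0r //.
  have := cardsD1 i setT; rewrite in_setT cardsT card_ord /= => cN.
  by apply: leq_trans le_Nk; rewrite [X in (_ <= X)%N]cN.
rewrite -/(F _) -(big_mkord xpredT F).
rewrite (reindex_inj rev_ord_inj) /=.
rewrite (eq_bigr (fun a : 'I_m.+1 => F a)) => [|a _]; last first.
  rewrite subSS /F /hsub -ltnS ltn_ord subKn -1?ltnS // mulrC.
  by congr (_ * _).
rewrite -(big_mkord xpredT F); have [le_mN | le_Nm] := leqP m.+1 N.
  rewrite [RHS](big_cat_nat (n := m.+1)) //= [X in _ + X]big_nat
    [X in _ + X]big1 ?addr0 //.
  by move=> k /andP[le_mk _]; rewrite F_gtm.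
rewrite [LHS](big_cat_nat (leq0n N) (ltnW le_Nm)) /= [X in _ + X]big_nat
    [X in _ + X]big1 ?addr0 //.
by move=> k /andP[le_Nk _]; rewrite F_geN.
Qed.

Definition hmx (alpha : nat -> nat) : 'M[{mpoly R[N]}]_N :=
  \matrix_(k, j) hsub (alpha j) (delta k).

(** The alternant factors as det E times a determinant of h's, with E independent of alpha; at alpha
    = delta the second matrix is unitriangular, so det E = a_delta. *)
Lemma alternant_hmx alpha : alternant X alpha = alternant X delta * \det (hmx alpha).
Proof.
pose E : 'M_N := \matrix_(i, k) gen phi_e X (setT :\ i) (delta k).
have altE a : alternant X a = \det E * \det (hmx a).
  rewrite /alternant -det_mulmx; congr (\det _); apply/matrixP=> i j.
  rewrite !mxE Xn_e_h; apply: eq_bigr => k _; by rewrite !mxE.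
rewrite [LHS]altE (altE delta) (_ : \det (hmx delta) = 1) ?mulr1 //.
rewrite det_trig.
  rewrite big1 // => i _; rewrite mxE /hsub leqnn subnn [LHS]gen_0 //.
apply/is_trig_mxP => i j lt_ij; rewrite mxE /hsub leqNgt.
by rewrite ltn_sub2l ?ltnS // (leq_ltn_trans _ (ltn_ord j)).
Qed.

Lemma alternant_lead (alpha : nat -> nat) :
    (forall i j, i < j < N -> alpha j < alpha i)%N ->
  let m := [multinom alpha i | i < N] in
  mlead (alternant X alpha) = m /\ (alternant X alpha)@_m = 1.
Proof.
move=> dec m; pose ms (s : 'S_N) := [multinom alpha (s i) | i < N].
have altE : alternant X alpha = \sum_(s : 'S_N) (-1) ^+ s *: 'X_[ms s].
  apply: eq_bigr => s _; rewrite -mul_mpolyC rmorph_sign; congr (_ * _).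
  by rewrite mpolyXE_id; apply: eq_bigr => i _; rewrite mxE mnmE.
have ms1 : ms 1%g = m by apply/mnmP=> i; rewrite !mnmE perm1.
have ms_lt s : s != 1%g -> (ms s < m)%O.
  move=> /perm_first[j s_id lt_s]; apply/ltmcP.
    rewrite !mdegE; under eq_bigr do rewrite mnmE.
    under [RHS]eq_bigr do rewrite mnmE.
    by rewrite [RHS](reindex_inj (@perm_inj _ s)).
  exists j => [i lt_ij|]; rewrite !mnmE; first by rewrite s_id.
  by rewrite dec // lt_s /=.
have coef_m : (alternant X alpha)@_m = 1.
  rewrite altE raddf_sum (bigD1 1%g) //= ms1 mcoeffZ mcoeffX eqxx mulr1 odd_perm1.
  rewrite big1 ?addr0 // => s /ms_lt; rewrite mcoeffZ mcoeffX.
  by case: eqP => [->|]; rewrite ?ltxx ?mulr0.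
split=> //; apply: mlead_char => [|m' lt_m]; first by rewrite coef_m oner_neq0.
rewrite altE raddf_sum /= big1 // => s _; rewrite mcoeffZ mcoeffX.
case: eqP => [eq_s|]; last by rewrite mulr0.
have [s1 | /ms_lt] := eqVneq s 1%g; last by rewrite eq_s (lt_gtF lt_m).
by move: lt_m; rewrite -eq_s s1 ms1 ltxx.
Qed.

Variables (k : nat) (la : intpart k).
Hypothesis le_kN : (k <= N)%N.

Lemma size_part_le : (size la <= N)%N.
Proof. exact: leq_trans (size_intpart la) le_kN. Qed.

Lemma schur_alternant :
  schur R N la * alternant X delta =
  alternant X (fun j => nth 0 la j + delta j)%N.
Proof.
by rewrite /schur size_part_le; apply/eqP/(xchooseP (alternant_dvd _ _)).
Qed.

Lemma delta_dec i j : (i < j < N)%N -> (delta j < delta i)%N.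
Proof.
by case/andP=> lt_ij lt_jN; rewrite ltn_sub2l ?ltnS // (leq_trans _ lt_jN).
Qed.

Lemma nth_part_dec i j : (i <= j)%N -> (nth 0 la j <= nth 0 la i)%N.
Proof.
move=> le_ij; have [lt_j|/(nth_default 0%N)->//] := ltnP j (size la).
have /andP[la_sorted _] := intpart_is_part la.
by apply: (sorted_leq_nth geq_trans geq_refl 0%N la_sorted);
   rewrite ?inE // (leq_ltn_trans le_ij).
Qed.

(** Leading terms multiply over a domain, so the quotient of alternants has leading exponent (la +
    delta) - delta. *)
Lemma schur_lead :
  mlead (schur R N la) = mnp N la /\ (schur R N la)@_(mnp N la) = 1.
Proof.
have [leadV coefV] := alternant_lead delta_dec.
have dec i j : (i < j < N)%N ->
    (nth 0 la j + delta j < nth 0 la i + delta i)%N.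
  move=> ij; rewrite -addnS leq_add ?delta_dec // nth_part_dec //.
  by case/andP: ij => /ltnW.
have [leadA coefA] := alternant_lead dec.
have V0 : alternant X delta != 0.
  by apply/eqP => V0; move/eqP: coefV; rewrite V0 mcoeff0 eq_sym oner_eq0.
have s0 : schur R N la != 0.
  apply/eqP=> s0; move/eqP: coefA.
  by rewrite -schur_alternant s0 mul0r mcoeff0 eq_sym oner_eq0.
have mA : [multinom (nth 0 la i + delta i)%N | i < N] =
    (mnp N la + [multinom delta i | i < N])%MM.
  by apply/mnmP => i; rewrite !mnmE.
have lead_s : mlead (schur R N la) = mnp N la.
  move: leadA; rewrite -schur_alternant mleadM // leadV mA.
  by move/addIm.
split=> //; move: coefA; rewrite -schur_alternant mA -lead_s -leadV mleadcM.
by rewrite leadV coefV mulr1.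
Qed.

Lemma schur_det : schur R N la = \det (hmx (fun j => nth 0 la j + delta j)%N).
Proof.
have [_ coefV] := alternant_lead delta_dec.
have V0 : alternant X delta != 0.
  by apply/eqP => V0; move/eqP: coefV; rewrite V0 mcoeff0 eq_sym oner_eq0.
by apply: (mulIf V0); rewrite schur_alternant alternant_hmx mulrC.
Qed.

(** In the Jacobi-Trudi determinant the identity gives h_la. Any other permutation s first moves
    some j to the right, so its index la_j + s j - j exceeds la_j there while the earlier ones are
    unchanged. *)
Lemma schur_in_h :
  inspan (genP R N phi_h (k:=k))
    (fun nu : intpart k => (mnp N la < mnp N (nu : intpart k))%O)
    (schur R N la - genP R N phi_h la).
Proof.
rewrite schur_det -det_tr /determinant (bigD1 1%g) //= odd_perm1 mul1r.
have -> : \prod_i (hmx (fun j => nth 0 la j + delta j)%N)^T i ((1%g : 'S_N) i) =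
    genP R N phi_h la.
  rewrite /genP -(genXs_mnp _ _ size_part_le) // /genXs big_tuple.
  apply: eq_bigr => i _; rewrite perm1 !mxE /hsub leq_addl addnK.
  by rewrite -mnm_tnth mnmE.
rewrite addrAC subrr add0r; apply: inspan_sum => s _ s1.
(* From (la_j + delta_j) - delta_(s j). The truncated subtraction is harmless: if some difference is
   negative, the whole term vanishes. *)
pose t := [tuple (nth 0 la j + s j - j)%N | j < N].
have t_nth (j : 'I_N) : nth 0%N t j = (nth 0 la j + s j - j)%N.
  by rewrite -tnth_nth tnth_mktuple.
have dE (j : 'I_N) : (delta (s j) <= nth 0 la j + delta j)%N =
    (j <= nth 0 la j + s j)%N.
  by have := ltn_ord j; have := ltn_ord (s j); rewrite /delta; lia.
have [/forallP all_le | /forallPn[j nle]] :=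
  boolP [forall j : 'I_N, j <= nth 0 la j + s j]%N; last first.
  rewrite (bigD1 j) //= !mxE /hsub dE (negPf nle) mul0r mulr0.
  exact: inspan0.
have -> : \prod_i (hmx (fun j => nth 0 la j + delta j)%N)^T i (s i) =
    genXs R N phi_h t.
  rewrite /genXs big_tuple; apply: eq_bigr => j _; rewrite !mxE /hsub dE all_le.
  rewrite tnth_mktuple; congr (h _); have := all_le j.
  by have := ltn_ord j; have := ltn_ord (s j); rewrite /delta; lia.
rewrite (_ : (-1) ^+ s = ((-1) ^+ s)%:MP) ?mul_mpolyC; last first.
  by rewrite rmorph_sign.
apply: inspanZ.
have sumn_t : sumn t = k.
  rewrite -[RHS](sumn_intpart la) -(mdeg_mnp size_part_le) sumnE big_tuple mdegE.
  apply: (@addIn (\sum_(j < N) j)%N); rewrite -big_split /=.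
  rewrite [X in (_ = _ + X)%N](reindex_inj (@perm_inj _ s)) -big_split /=.
  by apply: eq_bigr => j _; rewrite tnth_mktuple mnmE subnK.
apply: inspan_genXs => // nu ->.
apply: mnp_lt_normalize; rewrite ?size_tuple ?size_part_le ?sumn_intpart //.
have [j s_id lt_s] := perm_first s1; exists j => [i lt_ij|].
  have lt_iN := ltn_trans lt_ij (ltn_ord j).
  by rewrite (t_nth (Ordinal lt_iN)) s_id // addnK.
by rewrite t_nth; lia.
Qed.
End Schur.

(** * Schur's Q-functions *)

(* The coefficients of (1 + u) / (1 - u). *)
Definition phi_q (k : nat) : int := if k is 0 then 1 else 2.
(** The series of [phi_q] at -u, that is (1 - u) / (1 + u), its inverse. *)
Definition phi_qinv (k : nat) : int := (-1) ^+ k * phi_q k.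

Lemma phi_q_inv : (fun k => (k == 0)%N%:R) =1 convolution phi_qinv phi_q.
Proof.
have sumE k : \sum_(a < k.+1) phi_qinv a = (-1) ^+ k.
  elim: k => [|k IHk]; first by rewrite big_ord1.
  by rewrite big_ord_recr /= IHk /phi_qinv exprS; ring.
case=> [|k]; rewrite /convolution; first by rewrite big_ord1.
rewrite big_ord_recr /= subnn (eq_bigr (fun a : 'I_k.+1 => phi_qinv a * 2)).
  by rewrite -mulr_suml sumE /phi_qinv exprS /=; ring.
by move=> a _; rewrite subSn // -ltnS.
Qed.

(** * Partial fractions of the generating series of the q_r *)

Section PartialFractions.
Variables (K : fieldType) (I : finType) (x : I -> K).
Hypothesis x_inj : injective x.
Implicit Types (A : {set I}) (mu : seq nat).

Local Notation q := (gen phi_q x).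

Definition xratio i j := (x i + x j) / (x i - x j).

(** The coefficient of t^r in the polar part of prod (1 + x_i t) / (1 - x_i t): the residue factor
    at t = 1 / x_i is 2 times the product of the ratios. *)
Definition qfrac A r := \sum_(i in A) 2 * x i ^+ r * \prod_(j in A :\ i) xratio i j.

Lemma x_neq i j : i != j -> x i - x j != 0.
Proof. by move=> ne_ij; rewrite subr_eq0 (inj_eq x_inj). Qed.

Lemma setD1C A i j : A :\ i :\ j = A :\ j :\ i.
Proof. by rewrite !setDDl setUC. Qed.

(** The factor 1 - x_a t removes the pole of a and, at every other pole i, turns the ratio of i and
    a into 1 + x_a t. *)
Lemma qfrac_rec A a r : a \in A ->
  qfrac A r.+1 - x a * qfrac A r =
  qfrac (A :\ a) r.+1 + x a * qfrac (A :\ a) r.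
Proof.
move=> Aa; rewrite /qfrac 2!(big_setD1 a Aa) /= mulrDr opprD addrACA.
rewrite (_ : _ - x a * _ = 0) ?add0r; last by rewrite exprS; ring.
rewrite !mulr_sumr -sumrB -big_split; apply: eq_bigr => i.
rewrite !inE => /andP[ne_ia Ai].
have Aia : a \in A :\ i by rewrite !inE eq_sym ne_ia.
rewrite (big_setD1 a Aia) /= setD1C /xratio !exprS.
have := x_neq ne_ia; set P := \prod_(j in _) _; move=> ne0.
by field.
Qed.

Lemma q_rec A a r : a \in A ->
  q A r.+1 - x a * q A r = q (A :\ a) r.+1 + x a * q (A :\ a) r.
Proof.
move=> Aa; rewrite !(gen_D1 phi_q x _ Aa) mulr_sumr big_ord_recl.
rewrite -addrA -sumrB big_ord_recl /= !expr0 expr1 !mulr1 !mul1r !subn0 subSS subn0.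
rewrite big1 ?addr0; first by rewrite /=; ring.
move=> i _; rewrite /bump /= !add1n subSS !exprS.
by rewrite /=; ring.
Qed.

(** Both sides obey the same recurrence for removing a variable, which determines them by induction
    on r and on the number of variables once small exponents are known. *)
Lemma qfrac_q A r : qfrac A r.+1 = q A r.+1.
Proof.
have q0 B : q B 0 = 1 by apply: gen_0.
(* Exponent 0 is exceptional: the decomposition has the constant (-1)^#|B|, so [qfrac B 0] is 1 -
   (-1)^#|B| and not q_0 = 1. *)
have base B : qfrac B 0 = (odd #|B|).*2%:R /\ qfrac B 1 = q B 1.
  move: B => {}A.
  have [m] := ubnP #|A|; elim: m => // m IHm in A *; rewrite ltnS => le_Am.
  have [-> | [a Aa]] := set_0Vmem A.
    by rewrite /qfrac !big_set0 cards0 gen_set0.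
  have cA : #|A| = #|A :\ a|.+1 by rewrite (cardsD1 a) Aa.
  have /IHm[] : (#|A :\ a| < m)%N by rewrite -cA.
  move=> Ha0 Ha1.
  have H0 : qfrac A 0 = (odd #|A|).*2%:R.
    have [Aa0 | [b Aab]] := set_0Vmem (A :\ a).
      have -> : A = [set a] by rewrite -(setD1K Aa) Aa0 setU0.
      by rewrite /qfrac big_set1 setDv big_set0 cards1 !mulr1.
    have /setD1P[ne_ba Ab] := Aab.
    have cB : #|A| = #|A :\ b|.+1 by rewrite (cardsD1 b) Ab.
    have /IHm[] : (#|A :\ b| < m)%N by rewrite -cB.
    move=> Hb0 Hb1.
    have Aba : a \in A :\ b by rewrite !inE eq_sym ne_ba.
    (* The recurrences at a and at b share [qfrac A 1]; eliminating it leaves (x_b - x_a) times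
       [qfrac A 0]. *)
    have ra := qfrac_rec 0 Aa; have rb := qfrac_rec 0 Ab.
    have qa := q_rec 0 Aab; have qb := q_rec 0 Aba.
    rewrite setD1C !q0 !mulr1 in qa; rewrite !q0 !mulr1 in qb.
    have cab : #|A :\ b| = #|A :\ a| by apply/eqP; rewrite -eqSS -cA -cB.
    rewrite Ha0 Ha1 in ra; rewrite Hb0 Hb1 cab in rb.
    apply: (mulfI (x_neq ne_ba)); rewrite cA /=.
    have -> : ((~~ odd #|A :\ a|).*2%:R : K) = 2 - (odd #|A :\ a|).*2%:R.
      by case: odd; rewrite ?subrr ?subr0.
    move: ra rb qa qb; set u := _%:R; move: (qfrac A 1) (qfrac A 0) => t1 t0.
    move: (q (A :\ a) 1) (q (A :\ b) 1) (q (A :\ b :\ a) 1) => s1 s2 s3.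
    move=> /(canRL (subrK _)) -> e /(canRL (subrK _)) e1 /(canRL (subrK _)) e2.
    rewrite e1 e2 in e.
    apply/eqP; rewrite -subr_eq0; apply/eqP.
    have := esym e; move/eqP; rewrite -subr_eq0 => /eqP <-; ring.
  split=> //; apply: (addIr (- (x a * qfrac A 0))).
  rewrite qfrac_rec // Ha0 Ha1 H0.
  have /(canRL (subrK _)) -> := q_rec 0 Aa; rewrite !q0 cA /=.
  by case: odd; rewrite /= ?mulr0n; change (1.*2%:R : K) with (2 : K); ring.
elim: r => [|r IHr] in A *; first by case: (base A).
have [m] := ubnP #|A|; elim: m => // m IHm in A *; rewrite ltnS => le_Am.
have [-> | [a Aa]] := set_0Vmem A; first by rewrite /qfrac big_set0 gen_set0.
have cA : #|A| = #|A :\ a|.+1 by rewrite (cardsD1 a) Aa.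
apply: (addIr (- (x a * q A r.+1))); rewrite q_rec // -{1}IHr qfrac_rec //.
by rewrite IHm -?cA // IHr.
Qed.

(** Each step chooses the variable carrying the first remaining part. For strict mu this unfolds to
    the Hall-Littlewood sum; for one part it is [qfrac]. *)
Fixpoint Qrec mu A : K :=
  if mu is m :: mu' then
    \sum_(i in A) 2 * x i ^+ m * \prod_(j in A :\ i) xratio i j * Qrec mu' (A :\ i)
  else 1.

End PartialFractions.

(* The terms (c, t, s') of shifts s are those of the expansion of
   \prod_(r <- s) \sum_(b <= r) phi_qinv b * u^b * q_(r - b)
   into monomials c * u^t * q_s'. *)
Fixpoint shifts (s : seq nat) : seq (int * nat * seq nat) :=
  if s is r :: s' then
    [seq (phi_qinv b * e.1.1, (b + e.1.2)%N, (r - b)%N :: e.2)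
       | b <- iota 0 r.+1, e <- shifts s']
  else [:: (1, 0%N, [::])].

(** An entry (c, s) stands for c * q_s. Rewriting the q_r of the tail without x_i over all variables
    costs powers of x_i, which join the first part, as in the raising operator formula for Q_mu. *)
Fixpoint qexp (mu : seq nat) : seq (int * seq nat) :=
  if mu is m :: mu' then
    [seq (e.1 * c.1.1, (m + c.1.2)%N :: c.2) | e <- qexp mu', c <- shifts e.2]
  else [:: (1, [::])].

Lemma shifts_head s :
  exists2 L, shifts s = (1, 0%N, s) :: L & all (fun e => 0 < e.1.2)%N L.
Proof.
elim: s => [|r s [L sE L_gt0]]; first by exists [::].
have -> : shifts (r :: s) =
    [seq (phi_qinv 0 * e.1.1, (0 + e.1.2)%N, (r - 0)%N :: e.2) | e <- shifts s] ++
    [seq (phi_qinv b * e.1.1, (b + e.1.2)%N, (r - b)%N :: e.2)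
       | b <- iota 1 r, e <- shifts s] by [].
rewrite {1}sE map_cons subn0 mulr1 /=; eexists; first by [].
rewrite all_cat; apply/andP; split.
  by rewrite all_map; apply: sub_all L_gt0 => e.
by apply/allP=> _ /allpairsPdep[b [e [+ _ ->]]] /=; rewrite mem_iota; lia.
Qed.

Lemma shifts_sumn s e : e \in shifts s ->
  size e.2 = size s /\ (e.1.2 + sumn e.2 = sumn s)%N.
Proof.
elim: s e => [|r s IHs] e; first by rewrite inE => /eqP->.
case/allpairsPdep=> b [f []]; rewrite mem_iota /= => lt_b /IHs[<- <-] -> /=.
by split=> //; lia.
Qed.

(** Every nontrivial shift moves weight from later parts to an earlier one, which raises the
    sequence lexicographically. *)
Lemma qexp_head mu :
  exists2 L, qexp mu = (1, mu) :: L &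
    {in L, forall e, [/\ size e.2 = size mu, sumn e.2 = sumn mu & lexlt mu e.2]}.
Proof.
elim: mu => [|m mu [L muE L_gt]]; first by exists [::].
rewrite /= muE /=; have [S sE S_gt0] := shifts_head mu.
rewrite sE /= addn0 mul1r; eexists; first by [].
have S_sum e : e \in S -> size e.2 = size mu /\ (e.1.2 + sumn e.2 = sumn mu)%N.
  by move=> S_e; apply: shifts_sumn; rewrite sE inE S_e orbT.
move=> e; rewrite mem_cat => /orP[/mapP[c S_c ->] | /allpairsPdep[f [c [L_f S_c ->]]]].
  have [/= -> <-] := S_sum c S_c; rewrite addnA; split=> //=; exists 0%N => //=.
  by rewrite -[X in (X < _)%N]addn0 ltn_add2l (allP S_gt0).
have [size_f sumn_f lt_f] := L_gt f L_f; have [size_c sumn_c] := shifts_sumn S_c.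
split; rewrite /= ?size_c ?size_f //; first by rewrite -sumn_f -sumn_c addnA.
have [c0 | c_gt0] := posnP c.1.2.
  have [T fE T_gt0] := shifts_head f.2.
  move: S_c; rewrite fE inE => /predU1P[-> /= | /(allP T_gt0)]; last by rewrite c0.
  case: lt_f => i eq_i lt_i; exists i.+1 => //= -[|j] /=; first by rewrite addn0.
  by rewrite ltnS; apply: eq_i.
by exists 0%N => //=; rewrite -[X in (X < _)%N]addn0 ltn_add2l.
Qed.

(** Once the tail is expanded over all of A by [gen_D1_inv], the sum over the chosen variable is a
    [qfrac], that is a single q. *)
Lemma Qrec_qexp (K : fieldType) (I : finType) (x : I -> K) (A : {set I}) mu :
  injective x -> 0%N \notin mu ->
  Qrec x mu A =
  \sum_(e <- qexp mu) e.1%:~R * \prod_(r <- e.2) gen phi_q x A r.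
Proof.
move=> x_inj; elim: mu A => [|m mu IHmu] A /=.
  by rewrite big_seq1 big_nil mulr1.
rewrite inE negb_or eq_sym => /andP[m_neq0 mu0].
have shiftE i s : i \in A -> \prod_(r <- s) gen phi_q x (A :\ i) r =
    \sum_(c <- shifts s) c.1.1%:~R * x i ^+ c.1.2 *
      \prod_(r <- c.2) gen phi_q x A r.
  move=> Ai; elim: s => [|r s IHs]; first by rewrite /= big_seq1 !big_nil !mulr1.
  rewrite big_cons IHs (gen_D1_inv x r Ai phi_q_inv) big_allpairs_dep /=.
  have iotaE (G : nat -> K) : \sum_(b <- iota 0 r.+1) G b = \sum_(b < r.+1) G b.
    by rewrite -(big_mkord xpredT G) /index_iota subn0.
  rewrite iotaE mulr_suml.
  apply: eq_bigr => b _; rewrite mulr_sumr; apply: eq_bigr => e _ /=.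
  rewrite big_cons intrM exprD; move: (phi_qinv b)%:~R (e.1.1)%:~R => u v.
  by rewrite !mulrA; ring.
rewrite big_allpairs_dep /=.
transitivity (\sum_(i in A) \sum_(e <- qexp mu) \sum_(c <- shifts e.2)
   (e.1 * c.1.1)%:~R * (\prod_(r <- c.2) gen phi_q x A r) *
   (2 * x i ^+ (m + c.1.2) * \prod_(j in A :\ i) xratio x i j)).
  apply: eq_bigr => i Ai; rewrite IHmu // mulr_sumr; apply: eq_bigr => e _.
  rewrite shiftE // !mulr_sumr; apply: eq_bigr => c _.
  by rewrite rmorphM exprD /=; ring.
rewrite exchange_big; apply: eq_bigr => e _.
rewrite exchange_big; apply: eq_bigr => c _ /=.
rewrite -mulr_sumr big_cons -/(qfrac x A (m + c.1.2)).
(* The exponent is positive because the part m is; [qfrac] at 0 would not be q_0. *)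
have -> : (m + c.1.2 = (m + c.1.2).-1.+1)%N by rewrite prednK // addn_gt0 lt0n m_neq0.
by rewrite qfrac_q //; ring.
Qed.

(** * The Hall-Littlewood sum as a recursion on the largest part *)

Section Rearrangements.
Variables (K : fieldType) (I : finType) (x : I -> K) (D : nat).
Implicit Types (A : {set I}) (mu : seq nat) (f g : {ffun I -> 'I_D.+1}).

Definition content f : seq nat := [seq nat_of_ord (f i) | i <- enum I].

(* f is a rearrangement of (mu, 0, ..., 0) supported in A. *)
Definition arranges mu A f :=
  perm_eq [seq r <- content f | (0 < r)%N] mu &&
  [forall (i | i \notin A), f i == 0%N :> nat].

Definition hall_term A f : K :=
  (\prod_(i in A) x i ^+ f i) *
  \prod_(i in A) \prod_(j in A | (f j < f i)%N) xratio x i j.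

Definition set_val i (v : 'I_D.+1) f : {ffun I -> 'I_D.+1} :=
  [ffun j => if j == i then v else f j].

Lemma content_D1 i f :
  perm_eq (content f) (nat_of_ord (f i) :: [seq nat_of_ord (f j) | j <- rem i (enum I)]).
Proof.
by apply: (perm_map (fun j => nat_of_ord (f j)) (perm_to_rem _)); rewrite mem_enum.
Qed.

Lemma set_val_rem i v f :
  [seq nat_of_ord (set_val i v f j) | j <- rem i (enum I)] =
  [seq nat_of_ord (f j) | j <- rem i (enum I)].
Proof.
apply/eq_in_map => j; rewrite mem_rem_uniq ?enum_uniq // !inE => /andP[/negPf ne _].
by rewrite ffunE ne.
Qed.

(** The part m occurs once and exceeds all others, so a rearrangement has a unique position i with
    value m, and i contributes the ratios with all other elements of A. *)
Lemma hallP_rec m mu A : sorted gtn (m :: mu) -> 0%N \notin m :: mu -> (m <= D)%N ->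
  \sum_(f | arranges (m :: mu) A f) hall_term A f =
  \sum_(i in A) x i ^+ m * \prod_(j in A :\ i) xratio x i j *
    \sum_(f | arranges mu (A :\ i) f) hall_term (A :\ i) f.
Proof.
move=> mu_sorted; rewrite inE negb_or eq_sym -lt0n => /andP[m_gt0 mu0] le_mD.
have lt_m r : r \in mu -> (r < m)%N.
  have gtn_trans : transitive gtn by move=> ? ? ? /= h1 h2; apply: ltn_trans h2 h1.
  by move: mu_sorted; rewrite /= (path_sortedE gtn_trans) => /andP[/allP lt _] /lt.
pose mo : 'I_D.+1 := Ordinal (le_mD : (m < D.+1)%N).
have A_of f i : arranges (m :: mu) A f -> f i = mo -> i \in A.
  case/andP=> _ /forall_inP fA fi; apply: contraTT isT => /fA.
  by rewrite fi /= eqn0Ngt m_gt0.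
have rem_of f i : arranges (m :: mu) A f -> f i = mo ->
    perm_eq [seq r <- [seq nat_of_ord (f j) | j <- rem i (enum I)] | (0 < r)%N] mu.
  case/andP=> c_f _ fi; rewrite -(perm_cons m) -(permPr c_f) perm_sym.
  by have := perm_filter (ltn 0) (content_D1 i f); rewrite /= fi /= m_gt0.
have lt_of f i j : arranges (m :: mu) A f -> f i = mo -> j != i -> (f j < m)%N.
  move=> arr fi ne_ji; have [-> // | fj] := posnP (f j).
  apply: lt_m; rewrite -(perm_mem (rem_of f i arr fi)) mem_filter fj.
  by apply/mapP; exists j; rewrite // mem_rem_uniq ?enum_uniq // !inE ne_ji mem_enum.
have ex1 f : arranges (m :: mu) A f -> exists i, f i = mo.
  case/andP=> c_f _; have: m \in [seq r <- content f | (0 < r)%N].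
    by rewrite (perm_mem c_f) mem_head.
  rewrite mem_filter => /andP[_ /mapP[i _ mE]]; exists i; exact/val_inj/esym.
transitivity (\sum_(i in A)
    \sum_(f | arranges (m :: mu) A f && (f i == mo)) hall_term A f).
  under [RHS]eq_bigr do rewrite big_mkcondr.
  rewrite exchange_big; apply: eq_bigr => f arr.
  have [i fi] := ex1 f arr; rewrite (bigD1 i) ?(A_of f) //= fi eqxx.
  rewrite big1 ?addr0 // => j /andP[_ ne_ji]; case: eqP => // fj.
  by have := lt_of f i j arr fi ne_ji; rewrite fj ltnn.
apply: eq_bigr => i Ai.
(* Erasing the value m at i is inverse to placing it there; what is left are the rearrangements of
   mu supported in [A :\ i]. *)
rewrite (reindex_onto (set_val i mo) (set_val i ord0)) /=; last first.
  move=> f /andP[arr /eqP fi]; apply/ffunP=> j; rewrite !ffunE.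
  by case: eqP => // ->.
rewrite mulr_sumr; apply: eq_big => f; last first.
  case/andP=> /andP[arr _] _; rewrite /hall_term.
  set g := set_val i mo f.
  have gi : g i = mo by rewrite ffunE eqxx.
  have gj j : j != i -> g j = f j by move=> /negPf ne; rewrite ffunE ne.
  rewrite (big_setD1 i Ai) /= gi [X in _ * X](big_setD1 i Ai) /=.
  have -> : \prod_(j in A :\ i) x j ^+ g j = \prod_(j in A :\ i) x j ^+ f j.
    by apply: eq_bigr => j /setD1P[ne _]; rewrite gj.
  have -> : \prod_(j in A | (g j < g i)%N) xratio x i j = \prod_(j in A :\ i) xratio x i j.
    apply: eq_bigl => j; rewrite !inE gi andbC; have [-> | ne] := eqVneq j i.
      by rewrite gi ltnn.
    by rewrite (lt_of _ i) //= gi.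
  have -> : \prod_(k in A :\ i) \prod_(j in A | (g j < g k)%N) xratio x k j =
      \prod_(k in A :\ i) \prod_(j in A :\ i | (f j < f k)%N) xratio x k j.
    apply: eq_bigr => k /setD1P[ne_k _]; apply: eq_bigl => j; rewrite !inE (gj k) //.
    have [-> | ne] := eqVneq j i; last by rewrite gj.
    by rewrite gi ltnNge -(gj k) // ltnW ?andbF ?(lt_of _ i).
  by rewrite mulrACA !mulrA.
have filt0 (h : {ffun I -> 'I_D.+1}) : h i = ord0 ->
    perm_eq [seq r <- content h | (0 < r)%N]
    [seq r <- [seq nat_of_ord (h j) | j <- rem i (enum I)] | (0 < r)%N].
  by move=> hi; have := perm_filter (ltn 0) (content_D1 i h); rewrite /= hi.
have gi : set_val i mo f i = mo by rewrite ffunE eqxx.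
rewrite gi eqxx andbT; apply/idP/idP.
  case/andP=> arr /eqP e; have fi : f i = ord0 by rewrite -e ffunE eqxx.
  have := rem_of _ _ arr gi; rewrite set_val_rem => rem_mu.
  rewrite /arranges (perm_trans (filt0 f fi) rem_mu); apply/forall_inP => j.
  rewrite !inE negb_and negbK => /predU1P[-> | nAj]; first by rewrite fi.
  have /andP[_ /forall_inP/(_ j nAj)] := arr.
  by rewrite ffunE ifN //; apply: contraNneq nAj => ->.
move=> arr; have /andP[c_f /forall_inP f0] := arr.
have fi : f i = ord0 by apply/val_inj/eqP/f0; rewrite !inE eqxx.
apply/andP; split; last first.
  by apply/eqP/ffunP=> j; rewrite !ffunE; case: eqP => // ->.
apply/andP; split.
  have := perm_filter (ltn 0) (content_D1 i (set_val i mo f)).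
  rewrite set_val_rem gi /= m_gt0 => /perm_trans -> //; rewrite perm_cons.
  by rewrite perm_sym in c_f; rewrite perm_sym; apply: perm_trans c_f (filt0 f fi).
apply/forall_inP=> j nAj; rewrite ffunE ifN; last first.
  by apply: contraNneq nAj => ->.
by apply: f0; rewrite !inE negb_and nAj orbT.
Qed.

Lemma hallP_nil A : \sum_(f | arranges [::] A f) hall_term A f = 1.
Proof.
have arr0 f : arranges [::] A f = (f == [ffun=> ord0]).
  apply/andP/eqP => [[c_f _] | ->].
    apply/ffunP=> i; rewrite ffunE; apply/val_inj/eqP; rewrite /= -leqn0 leqNgt.
    apply/negP=> fi; move: c_f; rewrite perm_sym => /perm_mem/(_ (nat_of_ord (f i))).
    rewrite in_nil mem_filter fi => /esym/negbT/negP[].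
    by apply/mapP; exists i; rewrite ?mem_enum.
  split; last by apply/forall_inP=> i _; rewrite ffunE.
  rewrite (_ : [seq _ <- _ | _] = [::]) //; apply/eqP; rewrite -size_eq0 size_filter.
  by rewrite -leqn0 leqNgt -has_count; apply/hasPn=> _ /mapP[i _ ->]; rewrite ffunE.
rewrite (eq_bigl _ _ arr0) big_pred1_eq /hall_term big1 ?mul1r => [|i _].
  by rewrite big1 // => i _; rewrite big_pred0 // => j; rewrite !ffunE ltnn andbF.
by rewrite ffunE expr0.
Qed.

Lemma Qrec_hall mu A : sorted gtn mu -> 0%N \notin mu -> all (leq^~ D) mu ->
  Qrec x mu A = 2 ^+ size mu * \sum_(f | arranges mu A f) hall_term A f.
Proof.
elim: mu A => [|m mu IHmu] A mu_sorted mu0 mu_le.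
  by rewrite hallP_nil mulr1.
have /andP[le_m le_mu] := mu_le.
rewrite hallP_rec // mulr_sumr /=; apply: eq_bigr => i Ai.
rewrite IHmu //; last 2 first.
- by move: mu_sorted => /path_sorted.
- by move: mu0; rewrite inE negb_or => /andP[].
by rewrite exprS; ring.
Qed.

End Rearrangements.

Definition strict (s : seq nat) := sorted gtn s.

Lemma strict_uniq s : strict s -> uniq s.
Proof. by rewrite /strict gtn_sorted_uniq_geq => /andP[]. Qed.

Lemma perm_pad N a mu : size a = N -> 0%N \notin mu -> (size mu <= N)%N ->
  perm_eq a (mu ++ nseq (N - size mu) 0%N) = perm_eq [seq r <- a | (0 < r)%N] mu.
Proof.
move=> size_a mu0 le_N.
have mu_pos : [seq r <- mu | (0 < r)%N] = mu.
  by apply/all_filterP/allP=> r mu_r; rewrite lt0n; apply: contraNneq mu0 => <-.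
apply/idP/idP => [/(perm_filter (ltn 0)) | e].
  rewrite filter_cat /= mu_pos (_ : [seq r <- nseq _ _ | _] = [::]) ?cats0 //.
  by elim: (N - _)%N.
rewrite -(permPl (permEl (perm_filterC (ltn 0) a))) perm_cat //.
have -> : [seq r <- a | predC (ltn 0) r] = nseq (size [seq r <- a | predC (ltn 0) r]) 0%N.
  apply/all_pred1P/allP=> r; rewrite mem_filter /= -leqNgt leqn0.
  by case/andP.
rewrite -(perm_size e) -size_a size_filter size_filter.
by rewrite -(count_predC (ltn 0) a) addKn.
Qed.

Section HallP.
Variables (K : fieldType) (N : nat) (x : 'I_N -> K) (D : nat) (mu : seq nat).
Hypotheses (mu_strict : strict mu) (mu0 : 0%N \notin mu).
Hypotheses (size_mu : (size mu <= N)%N) (mu_le : all (leq^~ D) mu).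

Lemma nth_content (f : {ffun 'I_N -> 'I_D.+1}) (i : 'I_N) :
  nth 0%N (content f) i = f i.
Proof. by rewrite (nth_map i) ?size_enum_ord // nth_ord_enum. Qed.

Lemma size_content (f : {ffun 'I_N -> 'I_D.+1}) : size (content f) = N.
Proof. by rewrite size_map size_enum_ord. Qed.

Lemma hallP_arranges :
  hallP (-1) x mu =
  \sum_(f : {ffun 'I_N -> 'I_D.+1} | arranges mu setT f) hall_term x setT f.
Proof.
rewrite /hallP size_mu; set s := mu ++ _.
have content_inj : injective (fun f : {ffun 'I_N -> 'I_D.+1} => content f).
  move=> f1 f2 /= eq_f; apply/ffunP=> i.
  by apply: val_inj; rewrite /= -!nth_content eq_f.
have arrE (f : {ffun 'I_N -> 'I_D.+1}) : arranges mu setT f = perm_eq (content f) s.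
  rewrite perm_pad ?size_content //.
  apply/andP/idP => [[] // | e]; split=> //.
  by apply/forall_inP=> i; rewrite inE.
have perm_f : perm_eq (permutations s)
    [seq content f | f <- enum [pred f : {ffun 'I_N -> 'I_D.+1} | arranges mu setT f]].
  apply: uniq_perm; first exact: permutations_uniq.
    by rewrite (map_inj_uniq content_inj) enum_uniq.
  move=> a; rewrite mem_permutations; apply/idP/mapP => [eq_as | [g]].
    have size_a : size a = N.
      by rewrite (perm_size eq_as) size_cat size_nseq subnKC.
    have a_le r : r \in a -> (r <= D)%N.
      rewrite (perm_mem eq_as) mem_cat mem_nseq => /orP[/(allP mu_le) //|].
      by case/andP=> _ /eqP->.
    pose g := [ffun i : 'I_N => inord (nth 0%N a i) : 'I_D.+1].
    have gE : content g = a.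
      apply: (eq_from_nth (x0 := 0%N)) => [|i]; first by rewrite size_content.
      rewrite size_content => lt_i; rewrite (nth_content g (Ordinal lt_i)) ffunE.
      by rewrite inordK // ltnS a_le // mem_nth // size_a.
    by exists g; rewrite ?gE // mem_enum inE arrE gE.
  by rewrite mem_enum inE arrE => eq_gs ->.
rewrite (perm_big _ perm_f) big_map big_enum_cond /=.
apply: eq_big => [f | f _]; first by rewrite inE andbT.
rewrite /hall_term; congr (_ * _).
  by apply: eq_big => [i | i _]; rewrite ?inE // nth_content.
apply: eq_big => [i | i _]; rewrite ?inE //.
apply: eq_big => [j | j _]; rewrite ?inE ?nth_content //.
by rewrite /xratio mulN1r opprK.
Qed.

Lemma hallb_strict : hallb (-1) mu = 2 ^+ size mu :> K.
Proof.
rewrite /hallb undup_id ?strict_uniq //.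
rewrite big_seq (eq_bigr (fun=> 2)) => [|i mu_i].
  by rewrite -big_seq big_const_seq count_predT iter_mulr_1.
by rewrite count_uniq_mem ?strict_uniq // mu_i big_nat1 expr1 opprK.
Qed.

Lemma hallQ_qexp : injective x ->
  hallQ (-1) x mu =
  \sum_(e <- qexp mu) e.1%:~R * \prod_(r <- e.2) gen phi_q x setT r.
Proof.
move=> x_inj; rewrite -(Qrec_qexp setT x_inj mu0) (Qrec_hall _ _ mu_strict mu0 mu_le).
by rewrite /hallQ hallb_strict hallP_arranges.
Qed.

End HallP.

Section QPoly.
Variables (F : fieldType) (N : nat).
Implicit Types mu : seq nat.

Definition Qpoly mu : {mpoly F[N]} :=
  \sum_(e <- qexp mu) e.1%:~R *: genXs F N phi_q e.2.

Local Notation "p %:F" := (FracField.tofrac p).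

Lemma tofracX_inj : injective (fun i : 'I_N => ('X_i : {mpoly F[N]})%:F).
Proof.
move=> i j /eqP; rewrite tofrac_eq => /eqP/(congr1 (mcoeff U_(i)%MM)).
rewrite !mcoeffXU eqxx; case: eqP => // _ /eqP; by rewrite oner_eq0.
Qed.

(** In the fraction field the variables are distinct, so the partial fraction recursion applies to
    them; the resulting expansion in the q_r has no denominators. *)
Lemma schurQ_Qpoly mu : strict mu -> 0%N \notin mu -> (size mu <= N)%N ->
  schurQ F N mu = (Qpoly mu)%:F.
Proof.
move=> mu_strict mu0 size_mu.
have mu_le : all (leq^~ (sumn mu)) mu by apply/allP=> r; apply: mem_leq_sumn.
rewrite /schurQ (hallQ_qexp mu_strict mu0 size_mu mu_le tofracX_inj).
rewrite /Qpoly rmorph_sum; apply: eq_bigr => e _.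
rewrite -mul_mpolyC rmorphM rmorph_prod; congr (_ * _).
  by rewrite rmorph_int [RHS]rmorph_int.
apply: eq_bigr => r _; by rewrite /genX rmorph_gen.
Qed.

End QPoly.

Lemma prod_pairs (K : comNzRingType) N (G : 'I_N -> 'I_N -> K) :
  (forall i, G i i = 1) ->
  \prod_(i < N) \prod_(j < N) G i j =
  \prod_(i < N) \prod_(j < N | (i < j)%N) (G i j * G j i).
Proof.
move=> Gii; under [RHS]eq_bigr do rewrite big_split.
rewrite [RHS]big_split /= [X in _ * X](exchange_big_dep xpredT) //= -big_split /=.
apply: eq_bigr => i _; rewrite (bigID (fun j : 'I_N => i < j)%N) /=; congr (_ * _).
rewrite (bigD1 i) ?ltnn //= Gii mul1r; apply: eq_bigl => j.
by rewrite -leqNgt ltn_neqAle andbC.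
Qed.

(** * Leading terms of the Q-polynomials *)

Section QLead.
Variables (F : fieldType) (N D : nat).
Local Notation "p %:F" := (FracField.tofrac p).
Local Notation X := (fun i : 'I_N => 'X_i : {mpoly F[N]}).
Local Notation x := (fun i : 'I_N => ('X_i : {mpoly F[N]})%:F).
Implicit Types f : {ffun 'I_N -> 'I_D.+1}.

(* x_i - x_j times the factor of the pair {i, j} in the term of f of the
   Hall-Littlewood sum; its leading monomial does not depend on f. *)
Definition pair_factor f (i j : 'I_N) : {mpoly F[N]} :=
  if (f j < f i)%N then 'X_i + 'X_j
  else if (f i < f j)%N then - ('X_i + 'X_j) else 'X_i - 'X_j.

Definition pairs_factor f := \prod_(i < N) \prod_(j < N | (i < j)%N) pair_factor f i j.

Definition vandermonde : {mpoly F[N]} :=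
  \prod_(i < N) \prod_(j < N | (i < j)%N) ('X_i - 'X_j).

Definition monom f : 'X_{1..N} := [multinom (f i : nat) | i < N].

(** Denominators are cleared pair by pair: a pair with distinct values contributes one ratio, up to
    orientation, and a pair with equal values none. *)
Lemma hall_term_vandermonde f :
  vandermonde%:F * hall_term x setT f = ('X_[monom f] * pairs_factor f)%:F.
Proof.
rewrite /hall_term rmorphM mulrCA; congr (_ * _).
  rewrite mpolyXE_id rmorph_prod; apply: eq_big => [i|i _]; rewrite ?inE //.
  by rewrite mnmE rmorphXn.
have -> : \prod_(i in setT) \prod_(j in setT | (f j < f i)%N) xratio x i j =
    \prod_i \prod_j (if (f j < f i)%N then xratio x i j else 1).
  apply: eq_big => [i|i _]; rewrite ?inE // -big_mkcond /=.
  by apply: eq_bigl => j; rewrite inE.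
rewrite prod_pairs => [|i]; last by rewrite ltnn.
rewrite /vandermonde /pairs_factor !rmorph_prod -big_split; apply: eq_bigr => i _.
rewrite !rmorph_prod -big_split; apply: eq_bigr => j lt_ij /=.
have x_ij : x i - x j != 0.
  by apply: (x_neq (@tofracX_inj F N)); rewrite -(inj_eq val_inj) /= ltn_eqF.
have x_ji : x j - x i != 0 by rewrite -opprB oppr_eq0.
rewrite /pair_factor /xratio tofracB; move: x_ij x_ji.
case: (ltngtP (f j) (f i)) => _; rewrite ?tofracN ?(tofracB, tofracD) ?mulr1 //.
  by move=> uv _; rewrite mulrC divfK.
by move=> uv vu; rewrite mul1r mulrC -[X in _ * X]opprB mulrN divfK // addrC.
Qed.

Lemma mnmU_lt (i j : 'I_N) : (i < j)%N -> ((U_(j)%MM : 'X_{1..N}) < U_(i)%MM)%O.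
Proof.
move=> lt_ij; apply/ltmcP; first by rewrite !mdeg1.
exists i => [k lt_ki|]; rewrite !mnm1E.
  by rewrite -!(inj_eq val_inj) /= !gtn_eqF // (ltn_trans lt_ki).
by rewrite eqxx -(inj_eq val_inj) /= gtn_eqF.
Qed.

Lemma mlead_pair (a b : F) (i j : 'I_N) : (i < j)%N -> a != 0 ->
  mlead (a *: 'X_i + b *: 'X_j : {mpoly F[N]}) = U_(i)%MM /\
  mleadc (a *: 'X_i + b *: 'X_j : {mpoly F[N]}) = a.
Proof.
move=> lt_ij a0; have lead : mlead (a *: 'X_i + b *: 'X_j : {mpoly F[N]}) = U_(i)%MM.
  rewrite mleadDl (mleadZ _ a0) ?mleadXm //.
  by apply: (le_lt_trans (mleadZ_le _ _)); rewrite mleadXm mnmU_lt.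
split=> //; rewrite lead mcoeffD !mcoeffZ !mcoeffXU eqxx mulr1.
by rewrite -(inj_eq val_inj) /= gtn_eqF // mulr0 addr0.
Qed.

Lemma mlead_pair_factor f (i j : 'I_N) : (i < j)%N ->
  mlead (pair_factor f i j) = U_(i)%MM /\
  mleadc (pair_factor f i j) = if (f i < f j)%N then -1 else 1.
Proof.
move=> lt_ij; pose a : F := if (f i < f j)%N then -1 else 1.
pose b : F := if (f j < f i)%N then 1 else -1.
have -> : pair_factor f i j = a *: 'X_i + b *: 'X_j.
  rewrite /pair_factor /a /b; case: ltngtP; rewrite ?scale1r ?scaleN1r //.
  by rewrite opprD.
by apply: mlead_pair => //; rewrite /a; case: ifP; rewrite ?oppr_eq0 oner_eq0.
Qed.

(** This is the exponent delta, of the leading monomial of the Vandermonde product. *)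
Definition lead_pairs : 'X_{1..N} := (\sum_(i < N) \sum_(j < N | (i < j)%N) U_(i))%MM.

Lemma mlead_pairs_factor f :
  mlead (pairs_factor f) = lead_pairs /\
  ((forall i j : 'I_N, (i < j)%N -> (f j <= f i)%N) -> mleadc (pairs_factor f) = 1).
Proof.
have ne0 (i j : 'I_N) : (i < j)%N -> pair_factor f i j != 0.
  move=> lt_ij; rewrite -mleadc_eq0; have [_ ->] := mlead_pair_factor f lt_ij.
  by case: ifP; rewrite ?oppr_eq0 oner_eq0.
have ne0s (i : 'I_N) : \prod_(j < N | (i < j)%N) pair_factor f i j != 0.
  by rewrite prodf_seq_neq0; apply/allP=> j _; apply/implyP; apply: ne0.
have leads (i : 'I_N) : mlead (\prod_(j < N | (i < j)%N) pair_factor f i j) =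
    (\sum_(j < N | (i < j)%N) U_(i))%MM.
  rewrite mlead_prod => [|j _]; last exact: ne0.
  by apply: eq_bigr => j lt_ij; have [] := mlead_pair_factor f lt_ij.
have lead : mlead (pairs_factor f) = lead_pairs.
  by rewrite /pairs_factor mlead_prod //; apply: eq_bigr => i _.
split=> // f_dec; rewrite lead /lead_pairs.
under eq_bigr do rewrite -leads.
rewrite mleadc_prod big1 // => i _; rewrite leads.
rewrite (eq_bigr (fun j => mlead (pair_factor f i j))) => [|j lt_ij]; last first.
  by have [] := mlead_pair_factor f lt_ij.
rewrite mleadc_prod big1 // => j lt_ij.
by have [_ ->] := mlead_pair_factor f lt_ij; rewrite ltnNge f_dec.
Qed.

End QLead.

Section QpolyLead.
Variables (F : fieldType) (N : nat) (mu : seq nat).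
Hypotheses (mu_strict : strict mu) (mu0 : 0%N \notin mu).
Hypotheses (size_mu : (size mu <= N)%N) (two0 : (2 : F) != 0).

Local Notation D := (sumn mu).
Local Notation "p %:F" := (FracField.tofrac p).

Lemma strict_is_part : is_part mu.
Proof.
rewrite /is_part mu0 andbT; apply: sub_sorted mu_strict => a b /=.
exact: ltnW.
Qed.

Lemma strict_le : all (leq^~ D) mu.
Proof. by apply/allP=> r; apply: mem_leq_sumn. Qed.

Lemma monom_content (f : {ffun 'I_N -> 'I_D.+1}) : monom f = mnp N (content f).
Proof. by apply/mnmP=> i; rewrite !mnmE nth_content. Qed.

Lemma normalize_arranges (f : {ffun 'I_N -> 'I_D.+1}) :
  arranges mu setT f -> normalize (content f) = mu.
Proof.
case/andP=> c_f _; rewrite -[RHS](normalize_id strict_is_part).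
rewrite /normalize (elimT (perm_sortP geq_total geq_trans geq_anti _ _) c_f).
congr (sort _ _); apply/esym/all_filterP/allP => r mu_r.
by rewrite lt0n; apply: contraNneq mu0 => <-.
Qed.

Lemma monom_le (f : {ffun 'I_N -> 'I_D.+1}) :
  arranges mu setT f -> (monom f <= mnp N mu)%O.
Proof.
move=> arr; rewrite -[in X in (_ <= X)%O](normalize_arranges arr) monom_content.
by apply: mnp_normalize; rewrite size_content.
Qed.

Definition top_arr : {ffun 'I_N -> 'I_D.+1} := [ffun i : 'I_N => inord (nth 0%N mu i)].

Lemma top_arrE (i : 'I_N) : top_arr i = nth 0%N mu i :> nat.
Proof.
rewrite ffunE inordK // ltnS; have [lt_i | /(nth_default 0%N)-> //] := ltnP i (size mu).
by rewrite (allP strict_le) // mem_nth.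
Qed.

Lemma top_arr_arranges : arranges mu setT top_arr.
Proof.
rewrite /arranges -(perm_pad (size_content _) mu0 size_mu); apply/andP; split.
  rewrite (_ : content top_arr = mu ++ nseq (N - size mu) 0%N) //.
  apply: (eq_from_nth (x0 := 0%N)) => [|i].
    by rewrite size_content size_cat size_nseq subnKC.
  rewrite size_content => lt_i; rewrite (nth_content top_arr (Ordinal lt_i)).
  rewrite top_arrE nth_cat nth_nseq /=; case: ltnP => // /(nth_default 0%N)->.
  by case: ifP.
by apply/forall_inP=> i; rewrite inE.
Qed.

Lemma Qpoly_vandermonde :
  vandermonde F N * Qpoly F N mu =
  2 ^+ size mu *: \sum_(f : {ffun 'I_N -> 'I_D.+1} | arranges mu setT f)
                    'X_[monom f] * pairs_factor F f.
Proof.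
apply/eqP; rewrite -tofrac_eq tofracM -schurQ_Qpoly // /schurQ.
rewrite /hallQ (hallb_strict _ mu_strict).
rewrite (hallP_arranges _ mu0 size_mu strict_le) mulrCA mulr_sumr.
under eq_bigr do rewrite hall_term_vandermonde.
rewrite -rmorph_sum -mul_mpolyC tofracM; apply/eqP; congr (_ * _).
by rewrite !rmorphXn !rmorph_nat.
Qed.

(** After multiplication by the Vandermonde product each rearrangement f contributes x^f times a
    polynomial with leading exponent delta, and only the decreasing f reaches mu + delta. Cancelling
    the Vandermonde product leaves x^mu with coefficient 2^l(mu). *)
Lemma Qpoly_lead :
  (Qpoly F N mu)@_(mnp N mu) = 2 ^+ size mu /\
  forall m, (mnp N mu < m)%O -> (Qpoly F N mu)@_m = 0.
Proof.
pose f0 : {ffun 'I_N -> 'I_D.+1} := [ffun=> ord0].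
(* The constant function has no strict inequality, so the Vandermonde product is itself a
   [pairs_factor] and its leading term is known. *)
have VE : vandermonde F N = pairs_factor F f0.
  apply: eq_bigr => i _; apply: eq_bigr => j _.
  by rewrite /pair_factor !ffunE ltnn.
have [leadV] := mlead_pairs_factor F f0; rewrite -VE in leadV *.
move=> coefV.
have {}coefV : mleadc (vandermonde F N) = 1 by apply: coefV => i j _; rewrite !ffunE.
set R := \sum_(f : {ffun 'I_N -> 'I_D.+1} | arranges mu setT f)
                    'X_[monom f] * pairs_factor F f.
have coefR : R@_(mnp N mu + lead_pairs N) = 1.
  rewrite raddf_sum (bigD1 top_arr) ?top_arr_arranges //=.
  have coefT (f : {ffun 'I_N -> 'I_D.+1}) : arranges mu setT f ->
      ('X_[monom f] * pairs_factor F f)@_(mnp N mu + lead_pairs N) =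
      (monom f == mnp N mu)%:R * (pairs_factor F f)@_(lead_pairs N).
    move=> arr; rewrite mleadcMW ?mcoeffX //.
      by rewrite mleadXm monom_le.
    by have [->] := mlead_pairs_factor F f.
  have top_eq : monom top_arr = mnp N mu.
    by apply/mnmP=> i; rewrite !mnmE top_arrE.
  rewrite coefT ?top_arr_arranges // top_eq eqxx mul1r.
  have [lead1 coef1] := mlead_pairs_factor F top_arr.
  rewrite -[X in (pairs_factor F top_arr)@_X]lead1 coef1; last first.
    move=> i j lt_ij; rewrite !top_arrE.
    have [lt_j|/(nth_default 0%N)->//] := ltnP j (size mu).
    have /andP[mu_sorted _] := strict_is_part.
    by apply: (sorted_leq_nth geq_trans geq_refl 0%N mu_sorted);
       rewrite ?inE ?(ltn_trans lt_ij) // ltnW.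
  rewrite big1 ?addr0 // => f /andP[arr ne_f]; rewrite coefT //.
  case: eqP => [eq_m|]; rewrite ?mul0r //; case/eqP: ne_f; apply/ffunP=> i.
  apply/val_inj; rewrite /= top_arrE; have /mnmP/(_ i) := eq_m.
  by rewrite !mnmE.
have R_gt (m : 'X_{1..N}) : ((mnp N mu + lead_pairs N)%MM < m)%O -> R@_m = 0.
  move=> lt_m; rewrite raddf_sum big1 // => f arr /=.
  apply: mcoeff_gt_mlead; apply: le_lt_trans lt_m.
  apply: le_trans (mleadM_le _ _) _; apply: lem_add; first by rewrite mleadXm monom_le.
  by have [->] := mlead_pairs_factor F f.
have leadR : mlead R = (mnp N mu + lead_pairs N)%MM.
  by apply: mlead_char; rewrite ?coefR ?oner_neq0.
have p0 : (2 ^+ size mu : F) != 0 by rewrite expf_neq0.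
have R0 : R != 0 by rewrite -mleadc_eq0 leadR coefR oner_neq0.
have V0 : vandermonde F N != 0 by rewrite -mleadc_eq0 coefV oner_neq0.
have Q0 : Qpoly F N mu != 0.
  apply/eqP=> Q0; have := Qpoly_vandermonde; rewrite Q0 mulr0 => /esym/eqP.
  by rewrite mscalerI (negPf p0) (negPf R0).
have leadQ : mlead (Qpoly F N mu) = mnp N mu.
  have := mleadM V0 Q0; rewrite Qpoly_vandermonde mleadZ // leadR leadV addmC.
  by move/addmI.
split=> [|m lt_m]; last by apply: mcoeff_gt_mlead; rewrite leadQ.
have := mleadcM (vandermonde F N) (Qpoly F N mu).
rewrite Qpoly_vandermonde leadV leadQ -leadV coefV mul1r => <-.
by rewrite mcoeffZ leadV addmC coefR mulr1.
Qed.

End QpolyLead.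

Lemma nonstrict_split s : is_part s -> ~~ strict s ->
  exists u r v, s = u ++ r :: r :: v /\ (0 < r)%N.
Proof.
case/andP; elim: s => // a [|b s] IHs //.
rewrite /strict /= => /andP[le_ba s_sorted] s0.
move: (s0); rewrite in_cons negb_or => /andP[_ bs0].
rewrite negb_and -leqNgt => /orP[le_ab | /(IHs s_sorted bs0)[u [r [v [-> r_gt0]]]]].
  have ab : a = b by apply/eqP; rewrite eqn_leq le_ab.
  exists [::], a, s; rewrite lt0n ab; split=> //.
  by apply: contraNneq bs0 => ->; rewrite inE eqxx.
by exists (a :: u), r, v.
Qed.

(* From Q(t) Q(-t) = 1. *)
Lemma q_square (S : comNzRingType) (I : finType) (x : I -> S) (A : {set I}) r :
  (0 < r)%N ->
  gen phi_q x A r ^+ 2 =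
  \sum_(a < (2 * r).+1 | a != r :> nat)
     (- (-1) ^+ (r + a)) * (gen phi_q x A a * gen phi_q x A (2 * r - a)).
Proof.
move=> r_gt0; have genN a : gen phi_qinv x A a = (-1) ^+ a * gen phi_q x A a.
  have [m] := ubnP #|A|; elim: m => // m IHm in (A) a *; rewrite ltnS => le_Am.
  have [-> | [i Ai]] := set_0Vmem A.
    by rewrite !gen_set0; case: a => [|a]; rewrite ?mul1r // mulr0.
  rewrite !(gen_D1 _ _ _ Ai) mulr_sumr; apply: eq_bigr => -[b /= lt_b] _.
  rewrite IHm; last by apply: leq_trans le_Am; rewrite [X in (_ < X)%N](cardsD1 i) Ai.
  rewrite -[in X in _ = (-1) ^+ X * _](subnKC (lt_b : (b <= a)%N)) exprD.
  by rewrite /phi_qinv intrM rmorph_sign; ring.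
have := gen_mul x A (2 * r) phi_q_inv; rewrite gen_delta muln_eq0 /= eqn0Ngt r_gt0 /=.
have lt_r : (r < (2 * r).+1)%N by rewrite ltnS leq_pmull.
rewrite (bigD1 (Ordinal lt_r)) //= genN.
have -> : (2 * r - r = r)%N by rewrite mul2n -addnn addnK.
move=> /esym/eqP; rewrite addr_eq0 => /eqP e.
rewrite -[LHS](signrMK r) expr2 [X in _ * X]mulrA e mulrN -mulNr mulr_sumr.
apply: eq_big => [a | a _]; first by rewrite -(inj_eq val_inj).
by rewrite genN exprD; ring.
Qed.

(** * The Cauchy identities for Q and S *)

Section QCauchy.
Variables (F : fieldType) (N k : nat).
Hypotheses (le_kN : (k <= N)%N) (two0 : (2 : F) != 0).

(** For strict la the expansion [qexp] is inverted to first order. Otherwise some q_r^2 divides q_la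
    and is replaced by products q_a q_(2r-a), a different from r, each of which has an index above
    r. *)
Lemma Qpoly_genE (la : intpart k) :
  inspan (genP F N phi_q (k:=k))
    (fun nu : intpart k => (mnp N la < mnp N (nu : intpart k))%O)
    (genP F N phi_q la - (if strict la then Qpoly F N la else 0)).
Proof.
have size_la : (size la <= N)%N := leq_trans (size_intpart la) le_kN.
have spanP s : (size s <= N)%N -> sumn s = k -> lexlt la s ->
    inspan (genP F N phi_q (k:=k))
      (fun nu : intpart k => (mnp N la < mnp N (nu : intpart k))%O)
      (genXs F N phi_q s).
  move=> size_s sumn_s lt_s; apply: inspan_genXs => // nu ->.
  by apply: mnp_lt_normalize; rewrite ?sumn_intpart.
case: ifP => [la_strict | /negbT la_nstrict].
  have [L qE L_gt] := qexp_head la.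
  rewrite /Qpoly qE big_cons scale1r opprD addrA subrr add0r.
  apply/inspanN/inspan_sum => e L_e _; apply: inspanZ.
  have [size_e sumn_e lt_e] := L_gt e L_e.
  by apply: spanP; rewrite ?size_e ?sumn_e ?sumn_intpart.
have [u [r [v [laE r_gt0]]]] := nonstrict_split (intpart_is_part la) la_nstrict.
rewrite subr0 (_ : genP F N phi_q la = genXs F N phi_q (u ++ r :: r :: v)); last first.
  by rewrite /genP laE.
rewrite /genXs big_cat !big_cons /= [genX _ _ _ _ * (_ * _)]mulrA.
rewrite -expr2 q_square // mulr_suml mulr_sumr.
apply: inspan_sum => a _ ne_ar.
set c := - _; have -> : c = (- (-1) ^+ (r + a))%:MP.
  by rewrite /c rmorphN rmorph_sign.
(* The larger index comes first, so that the sequence grows exactly where the first r stood. *)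
set s := u ++ (maxn a (2 * r - a) :: minn a (2 * r - a) :: v)%N.
have le_a : (a <= 2 * r)%N by rewrite -ltnS.
have -> : \prod_(r <- u) genX F N phi_q r * ((- (-1) ^+ (r + a))%:MP *
     (genX F N phi_q a * genX F N phi_q (2 * r - a)) * \prod_(r <- v) genX F N phi_q r) =
   (- (-1) ^+ (r + a)) *: genXs F N phi_q s.
  rewrite /genXs /s big_cat !big_cons -mul_mpolyC /=.
  by rewrite /maxn /minn; case: ifP => _; ring.
apply: inspanZ; apply: spanP.
- by move: size_la; rewrite laE /s !size_cat.
- rewrite -(sumn_intpart la) laE /s !sumn_cat /=.
  by move: le_a; rewrite /maxn /minn; case: ifP; lia.
by rewrite laE; apply: lexlt_cat; rewrite /maxn; case: ifP; lia.
Qed.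

(** The coefficient of y^alpha in the expansion of prod (1 + x_i y_j) / (1 - x_i y_j) as the sum of
    2^-l(mu) Q_mu(x) Q_mu(y). *)
Lemma q_cauchy (alpha : 'X_{1..N}) : mdeg alpha = k ->
  genXs F N phi_q alpha =
  \sum_(mu : intpart k | strict mu)
     ((2 ^+ size mu)^-1 * (Qpoly F N mu)@_alpha) *: Qpoly F N mu.
Proof.
have size_p (mu : intpart k) : (size mu <= N)%N := leq_trans (size_intpart mu) le_kN.
have pos (mu : intpart k) : 0%N \notin (mu : seq nat) by case/andP: (intpart_is_part mu).
apply: (cauchy _ le_kN (St := fun mu : intpart k => strict mu)
          (B := fun mu : intpart k => Qpoly F N mu)
          (d := fun mu : intpart k => 2 ^+ size mu)) => //.
- exact: Qpoly_genE.
- by move=> mu la mu_s; apply: (Qpoly_lead mu_s (pos mu) (size_p mu) two0).2.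
- by move=> mu mu_s; apply: (Qpoly_lead mu_s (pos mu) (size_p mu) two0).1.
by move=> mu _; rewrite expf_neq0.
Qed.

Lemma h_cauchy (alpha : 'X_{1..N}) : mdeg alpha = k ->
  genXs F N phi_h alpha =
  \sum_(mu : intpart k) (schur F N mu)@_alpha *: schur F N mu.
Proof.
move=> deg_a; rewrite (cauchy _ le_kN (St := predT)
          (B := fun mu : intpart k => schur F N mu) (d := fun=> 1)) //.
- by apply: eq_bigr => mu _; rewrite invr1 mul1r.
- by move=> la; rewrite -opprB; apply/inspanN/schur_in_h.
- move=> mu la _ lt_mu; apply: mcoeff_gt_mlead.
  by have [-> _] := schur_lead F mu le_kN.
- by move=> mu _; have [_ ->] := schur_lead F mu le_kN.
by move=> mu _; apply: oner_neq0.
Qed.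

End QCauchy.

(** * Multiplicities *)

Section Multiplicities.
Local Open Scope nat_scope.
Implicit Types (s t : seq nat) (m : nat -> nat).

Lemma count_part_of_mult b m i :
  count_mem i (part_of_mult b m) = if 0 < i <= b then m i else 0.
Proof.
rewrite /part_of_mult count_flatten -map_comp.
have eq_m : [seq (count_mem i) (nseq (m j) j) | j <- iota 1 b] =
    [seq (if j == i then m i else 0) | j <- iota 1 b].
  by apply: eq_map => j; rewrite count_nseq /=; case: eqP => [->|_]; rewrite ?mul1n.
rewrite map_rev (perm_sumn (permEl (perm_rev _))) [map _ _]eq_m.
have -> : (0 < i <= b) = (i \in iota 1 b) by rewrite mem_iota; lia.
have := iota_uniq 1 b; elim: (iota 1 b) => //= j s IHs /andP[sj /IHs ->].
rewrite inE eq_sym; case: eqP sj => [-> /negPf-> | _ _] /=; first by rewrite addn0.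
by rewrite add0n.
Qed.

Lemma part_of_mult_is_part b m : is_part (part_of_mult b m).
Proof.
apply/andP; split; last first.
  by rewrite -has_pred1 has_count count_part_of_mult.
rewrite /part_of_mult; elim: b => // b IHb.
rewrite -[b.+1]addn1 iotaD rev_cat /= add1n; move: IHb.
set s := flatten _ => s_sorted.
have s_le : {in s, forall r, r <= b}.
  move=> r /flatten_mapP[j]; rewrite mem_rev mem_iota => j_b.
  by rewrite mem_nseq => /andP[_ /eqP->]; lia.
elim: (m b.+1) => //= c; rewrite !(path_sortedE geq_trans) => ->; rewrite andbT.
apply/allP=> r; rewrite mem_cat mem_nseq => /orP[/andP[_ /eqP->] | /s_le/leqW //].
exact: geq_refl.
Qed.

Lemma part_ext s t : is_part s -> is_part t ->
  (forall i, count_mem i s = count_mem i t) -> s = t.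
Proof.
case/andP=> s_sorted _ /andP[t_sorted _] eq_c.
apply: (sorted_eq geq_trans geq_anti) => //.
by apply/allP=> i _; rewrite /= eq_c.
Qed.

Lemma count_gt s D i : {in s, forall r, r <= D} -> D < i -> count_mem i s = 0.
Proof.
by move=> le_D lt_i; apply/count_memPn; apply: contraL lt_i => /le_D; rewrite -leqNgt.
Qed.

Lemma sumn_multiplicity s D : {in s, forall r, r <= D} ->
  sumn s = \sum_(i < D.+1) i * count_mem (i : nat) s.
Proof.
elim: s => [|a s IHs] le_D; first by rewrite big1 // => i _; rewrite muln0.
rewrite /= IHs => [|r s_r]; last by rewrite le_D // inE s_r orbT.
under [RHS]eq_bigr do rewrite mulnDr; rewrite big_split /=; congr (_ + _).
have lt_a : a < D.+1 by rewrite ltnS le_D // mem_head.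
rewrite (bigD1 (Ordinal lt_a)) //= eqxx muln1 big1 ?addn0 // => i.
by rewrite -(inj_eq val_inj) /= eq_sym => /negPf->; rewrite muln0.
Qed.

Lemma size_multiplicity s D : {in s, forall r, r <= D} ->
  size s = \sum_(i < D.+1) count_mem (i : nat) s.
Proof.
elim: s => [|a s IHs] le_D; first by rewrite big1.
rewrite /= IHs => [|r s_r]; last by rewrite le_D // inE s_r orbT.
rewrite big_split /= -add1n; congr (_ + _).
have lt_a : a < D.+1 by rewrite ltnS le_D // mem_head.
rewrite (bigD1 (Ordinal lt_a)) //= eqxx big1 ?addn0 // => i.
by rewrite -(inj_eq val_inj) /= eq_sym => /negPf->.
Qed.

Lemma count0_part s : is_part s -> count_mem 0 s = 0.
Proof. by case/andP=> _ s0; apply/count_memPn. Qed.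

Lemma count_part_r s i : is_part s -> count_mem i (part_r s) = odd (count_mem i s).
Proof.
move=> s_part; rewrite count_part_of_mult.
case: posnP => [-> | i_gt0] /=; first by rewrite count0_part.
by case: leqP => // /(count_gt (@mem_leq_sumn s)) ->.
Qed.

Lemma count_part_d s i : is_part s -> count_mem i (part_d s) = (count_mem i s)./2.
Proof.
move=> s_part; rewrite count_part_of_mult.
case: posnP => [-> | i_gt0] /=; first by rewrite count0_part.
by case: leqP => // /(count_gt (@mem_leq_sumn s)) ->.
Qed.

Lemma part_of_mult_le b m r : r \in part_of_mult b m -> r <= b.
Proof.
rewrite -has_pred1 has_count count_part_of_mult; case: ifP => //.
by case/andP.
Qed.

Lemma sumn_part_rd s : is_part s -> sumn (part_r s) + 2 * sumn (part_d s) = sumn s.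
Proof.
move=> s_part; rewrite [RHS](sumn_multiplicity (@mem_leq_sumn s)).
rewrite (sumn_multiplicity (@part_of_mult_le _ _)).
rewrite (sumn_multiplicity (@part_of_mult_le _ _)).
rewrite big_distrr -big_split /=; apply: eq_bigr => i _.
rewrite count_part_r // count_part_d // mulnCA -mulnDr.
by rewrite mul2n odd_double_half.
Qed.

Lemma size_part_rd s : is_part s -> size (part_r s) + 2 * size (part_d s) = size s.
Proof.
move=> s_part; rewrite [RHS](size_multiplicity (@mem_leq_sumn s)).
rewrite (size_multiplicity (@part_of_mult_le _ _)).
rewrite (size_multiplicity (@part_of_mult_le _ _)).
rewrite big_distrr -big_split /=; apply: eq_bigr => i _.
by rewrite count_part_r // count_part_d // mul2n odd_double_half.
Qed.

Lemma strict_uniqE s : is_part s -> strict s = uniq s.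
Proof. by case/andP=> s_sorted _; rewrite /strict gtn_sorted_uniq_geq s_sorted andbT. Qed.

Lemma strict_part_r s : is_part s -> strict (part_r s).
Proof.
move=> s_part; rewrite strict_uniqE ?part_of_mult_is_part //.
apply: count_mem_uniq => i; rewrite -has_pred1 has_count count_part_r //.
by case: odd.
Qed.

(** The inverse of la -> (la^r, la^d) on pairs whose first component is strict. *)
Definition join_rd rho nu := normalize (rho ++ nu ++ nu).

Lemma count_normalize s i : 0 < i -> count_mem i (normalize s) = count_mem i s.
Proof.
move=> i_gt0; rewrite (elimT seq.permP (permEl (perm_sort _ _))) count_filter.
by apply: eq_count => j /=; case: eqP => // ->; rewrite i_gt0.
Qed.

Lemma count_join rho nu i : is_part rho -> is_part nu ->
  count_mem i (join_rd rho nu) = count_mem i rho + (count_mem i nu).*2.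
Proof.
move=> rho_part nu_part; case: (posnP i) => [-> | i_gt0].
  by rewrite !count0_part ?normalize_is_part.
by rewrite count_normalize // !count_cat addnn.
Qed.

Lemma count_strict s i : is_part s -> strict s -> count_mem i s <= 1.
Proof. by move=> s_part; rewrite strict_uniqE // => /count_uniq_mem->; case: (_ \in _). Qed.

Lemma part_r_join rho nu : is_part rho -> is_part nu -> strict rho ->
  part_r (join_rd rho nu) = rho.
Proof.
move=> rho_part nu_part rho_strict.
apply: part_ext => // [|i]; first exact: part_of_mult_is_part.
rewrite count_part_r ?normalize_is_part // count_join // oddD odd_double addbF.
by case: (count_mem i rho) (count_strict i rho_part rho_strict) => [|[]].
Qed.

Lemma part_d_join rho nu : is_part rho -> is_part nu -> strict rho ->
  part_d (join_rd rho nu) = nu.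
Proof.
move=> rho_part nu_part rho_strict.
apply: part_ext => // [|i]; first exact: part_of_mult_is_part.
rewrite count_part_d ?normalize_is_part // count_join //.
by case: (count_mem i rho) (count_strict i rho_part rho_strict) => [|[]] // _;
   rewrite halfD ?odd_double ?doubleK.
Qed.

Lemma part_rd_inj s t : is_part s -> is_part t ->
  part_r s = part_r t -> part_d s = part_d t -> s = t.
Proof.
move=> s_part t_part eq_r eq_d; apply: part_ext => // i.
rewrite -[LHS]odd_double_half -[RHS]odd_double_half.
by rewrite -!count_part_r // -!count_part_d // eq_r eq_d.
Qed.

End Multiplicities.

(** The bijection mu -> (mu^r, mu^d) at a fixed size B of mu^d, which leaves n - 2B for mu^r. The
    summand takes plain sequences, since [part_r] and [part_d] do not carry sizes in their types. *)
Lemma big_intpart_rd (V : nmodType) (n B : nat) (G : seq nat -> seq nat -> V) :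
    (2 * B <= n)%N ->
  \sum_(mu : intpart n | sumn (part_d mu) == B) G (part_r mu) (part_d mu) =
  \sum_(rho : intpart (n - 2 * B) | strict rho) \sum_(nu : intpart B) G rho nu.
Proof.
move=> le_Bn.
pose L1 := [seq (part_r mu, part_d mu)
             | mu : intpart n <- enum [pred mu : intpart n | sumn (part_d mu) == B]].
pose L2 := [seq (parts rho, parts nu)
             | rho : intpart _ <- enum [pred rho : intpart (n - 2 * B) | strict rho],
               nu : intpart _ <- enum {: intpart B}].
have perm_L : perm_eq L1 L2.
  apply: uniq_perm.
  - rewrite map_inj_uniq ?enum_uniq // => mu1 mu2 [eq_r eq_d].
    by apply: intpart_inj; apply: part_rd_inj; rewrite ?intpart_is_part.
  - rewrite allpairs_uniq ?enum_uniq // => -[r1 n1] [r2 n2] _ _ [/= eq_r eq_n].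
    by rewrite (intpart_inj eq_r) (intpart_inj eq_n).
  move=> [s t]; apply/mapP/allpairsP => [[mu] | [[rho nu] /=]].
    rewrite mem_enum inE => /eqP sum_d [-> ->].
    have mu_part := intpart_is_part mu.
    have sum_r : sumn (part_r mu) = (n - 2 * B)%N.
      by have := sumn_part_rd mu_part; rewrite sumn_intpart sum_d; lia.
    have [rho rhoE] := exists_intpart (part_of_mult_is_part _ _ : is_part (part_r mu)) sum_r.
    have [nu nuE] := exists_intpart (part_of_mult_is_part _ _ : is_part (part_d mu)) sum_d.
    exists (rho, nu); rewrite /= !mem_enum !inE rhoE nuE; split=> //.
    exact: strict_part_r.
  rewrite !mem_enum !inE => -[rho_strict _ [-> ->]].
  have rho_part := intpart_is_part rho; have nu_part := intpart_is_part nu.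
  have sum_j : sumn (join_rd rho nu) = n.
    by rewrite sumn_normalize !sumn_cat !sumn_intpart; lia.
  have [mu muE] := exists_intpart (normalize_is_part _ : is_part (join_rd rho nu)) sum_j.
  by exists mu; rewrite ?mem_enum ?inE muE ?part_d_join ?part_r_join ?sumn_intpart.
have : \sum_(p <- L1) G p.1 p.2 = \sum_(p <- L2) G p.1 p.2 by apply: perm_big.
rewrite /L1 /L2 big_map big_allpairs_dep !big_enum_cond /= => eG.
rewrite -[LHS](eq_bigl _ _ (fun mu => andbT _)) eG.
apply: eq_big => [rho | rho _]; first by rewrite andbT.
by rewrite big_enum.
Qed.

(** * The Cauchy identity of Q_(mu^r)(x) S_(mu^d)(x^2) *)

Definition phi_even (k : nat) : int := (~~ odd k)%:R.

(* 1 / (1 - u)^2 = 1 / (1 - u^2) * (1 + u) / (1 - u) *)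
Lemma phi_hh_even : phi_hh =1 convolution phi_even phi_q.
Proof.
have sumE k : \sum_(a < k) phi_even a = (uphalf k)%:R.
  elim: k => [|k IHk]; first by rewrite big_ord0.
  rewrite big_ord_recr /= IHk /phi_even -natrD; congr (_%:R).
  by rewrite uphalf_half; case: odd => /=; lia.
move=> k; rewrite /convolution big_ord_recr /= subnn mulr1.
rewrite (eq_bigr (fun a : 'I_k => phi_even a * 2)) => [|a _]; last first.
  by rewrite -(prednK (_ : 0 < k - a)%N) ?subn_gt0.
rewrite -mulr_suml sumE /phi_hh /phi_even -[2]/(2%:R) -natrM -natrD.
by congr (_%:R); rewrite uphalf_half; have := odd_double_half k; case: odd => /=; lia.
Qed.

Lemma sum_even (V : nmodType) (G : nat -> V) c :
  \sum_(a < (2 * c).+1) (if odd a then 0 else G a./2) = \sum_(b < c.+1) G b.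
Proof.
elim: c => [|c IHc]; first by rewrite !big_ord1.
rewrite big_ord_recr (_ : 2 * c.+1 = (2 * c).+2)%N; last by lia.
rewrite big_ord_recr /= IHc mul2n /= odd_double /= addr0.
rewrite [RHS]big_ord_recr; congr (_ + _).
by rewrite doubleK.
Qed.

(** Each factor is 1 / (1 - x_i^2 t^2), so the product is the series of the h_b(x^2) in t^2. *)
Lemma gen_even (S : comNzRingType) (I : finType) (x : I -> S) (A : {set I}) r :
  gen phi_even x A r = if odd r then 0 else gen phi_h (fun i => x i ^+ 2) A r./2.
Proof.
have [m] := ubnP #|A|; elim: m => // m IHm in A r *; rewrite ltnS => le_Am.
have [-> | [i Ai]] := set_0Vmem A.
  by rewrite !gen_set0; case: r => [|[|r]] //=; case: ifP.
have lt_A : (#|A :\ i| < m)%N.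
  by apply: leq_trans le_Am; rewrite [X in (_ < X)%N](cardsD1 i) Ai.
rewrite (gen_D1 _ _ _ Ai); case: ifP => r_odd.
  rewrite big1 // => -[a /= lt_a] _; rewrite /phi_even IHm //.
  by rewrite oddB // r_odd; case: odd; rewrite /= ?mulr0 // !mul0r.
have rE : r = (2 * r./2)%N by rewrite mul2n -{1}(odd_double_half r) r_odd.
rewrite (gen_D1 _ _ _ Ai) -(sum_even (fun a => (phi_h a)%:~R * (x i ^+ 2) ^+ a *
   gen phi_h (fun j => x j ^+ 2) (A :\ i) (r./2 - a))) -rE.
apply: eq_bigr => -[a /= lt_a] _; rewrite /phi_even.
case: ifP => a_odd; first by rewrite !mul0r.
have aE : (2 * a./2 = a)%N by rewrite mul2n -{2}(odd_double_half a) a_odd.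
rewrite IHm // oddB // r_odd a_odd /= -exprM aE.
by rewrite (_ : (r - a)./2 = r./2 - a./2)%N //; lia.
Qed.

Section Squares.
Variables (F : fieldType) (N : nat).

Definition squares : N.-tuple {mpoly F[N]} := [tuple 'X_i ^+ 2 | i < N].

Local Notation "p ^sq" := (comp_mpoly squares p) (at level 2, format "p ^sq").
Implicit Types m : 'X_{1..N}.

Lemma genX_sq r :
  (genX F N phi_h r)^sq = gen phi_h (fun i : 'I_N => 'X_i ^+ 2 : {mpoly F[N]}) setT r.
Proof.
rewrite /genX rmorph_gen; apply: eq_gen => // i /=.
by rewrite comp_mpolyXU -tnth_nth tnth_mktuple.
Qed.

(** The bound D is independent of r: distributing a product of such sums requires a common index
    type. *)
Lemma genX_hh r D : (r <= D)%N ->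
  genX F N phi_hh r = \sum_(b < D.+1 | (2 * b <= r)%N)
     genX F N phi_q (r - 2 * b) * (genX F N phi_h b)^sq.
Proof.
move=> le_rD; rewrite /genX (gen_mul _ _ _ phi_hh_even).
pose G b := if (2 * b <= r)%N then genX F N phi_q (r - 2 * b) *
   (genX F N phi_h b)^sq else 0.
rewrite [RHS]big_mkcond -(sum_even G) /=.
pose H a := if odd a then 0 else G a./2.
have H_gt a : (r < a)%N -> H a = 0.
  rewrite /H /G; case: ifP => // a_odd lt_a; rewrite ifN // -ltnNge.
  by rewrite mul2n; have := odd_double_half a; rewrite a_odd add0n => ->.
rewrite -/(H _) (eq_bigr (fun a : 'I_r.+1 => H a)) => [|a _]; last first.
  rewrite /H /G gen_even; case: ifP => a_odd; first by rewrite mul0r.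
  have aE : (2 * a./2 = a)%N by rewrite mul2n -{2}(odd_double_half a) a_odd.
  by rewrite aE -ltnS ltn_ord genX_sq mulrC.
rewrite (big_ord_widen (2 * D).+1 H); last by lia.
rewrite big_mkcond; apply: eq_bigr => a _; case: ltnP => // le_ra.
exact/esym/H_gt.
Qed.

Definition mnm_of D (b : {ffun 'I_N -> 'I_D.+1}) : 'X_{1..N} :=
  [multinom (b i : nat) | i < N].

Definition fits D m (b : {ffun 'I_N -> 'I_D.+1}) : bool :=
  [forall i, 2 * b i <= m i]%N.

Lemma fitsP D m (b : {ffun 'I_N -> 'I_D.+1}) :
  fits m b = (mnm_of b *+ 2 <= m)%MM.
Proof.
apply/forallP/mnm_lepP => le_b i; have := le_b i; rewrite mulmnE mnmE.
  by rewrite mulnC.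
by rewrite mulnC.
Qed.

Lemma genXs_mnm phi m : genXs F N phi m = \prod_(i < N) genX F N phi (m i).
Proof. by rewrite /genXs big_tuple; apply: eq_bigr => i _; rewrite -mnm_tnth. Qed.

Lemma genXs_hh D m : (forall i, m i <= D)%N ->
  genXs F N phi_hh m = \sum_(b : {ffun 'I_N -> 'I_D.+1} | fits m b)
     genXs F N phi_q (m - mnm_of b *+ 2)%MM * (genXs F N phi_h (mnm_of b))^sq.
Proof.
move=> le_mD; rewrite genXs_mnm.
under eq_bigr => i _ do rewrite (genX_hh (le_mD i)) big_mkcond.
rewrite bigA_distr_bigA [RHS]big_mkcond; apply: eq_bigr => b _.
set mq := (m - _)%MM; set mb := mnm_of b.
rewrite /fits; case: (boolP [forall i, _]) => [/forallP fit | /forallPn[i nfit]].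
  under eq_bigr do rewrite fit; rewrite big_split; congr (_ * _).
    rewrite genXs_mnm; apply: eq_bigr => i _.
    by rewrite mnmBE mulmnE mnmE mulnC.
  rewrite genXs_mnm rmorph_prod; apply: eq_bigr => i _.
  by rewrite mnmE.
by rewrite (bigD1 i) //= (negPf nfit) mul0r.
Qed.

Lemma mcoeff_mul_sq (P p : {mpoly F[N]}) D m : (forall i, m i <= D)%N ->
  (P * p^sq)@_m = \sum_(b : {ffun 'I_N -> 'I_D.+1} | fits m b)
     P@_(m - mnm_of b *+ 2)%MM * p@_(mnm_of b).
Proof.
move=> le_mD; elim/mpolyind: p => [|c u p _ _ IHp].
  by rewrite rmorph0 mulr0 mcoeff0 big1 // => b _; rewrite mcoeff0 mulr0.
rewrite comp_mpolyD mulrDr mcoeffD IHp.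
under [RHS]eq_bigr do rewrite mcoeffD mulrDr; rewrite big_split; congr (_ + _).
have sqX : ('X_[u])^sq = 'X_[u *+ 2] :> {mpoly F[N]}.
  rewrite comp_mpolyX mpolyXE_id; apply: eq_bigr => i _.
  by rewrite tnth_mktuple -exprM mulmnE mulnC.
rewrite comp_mpolyZ -scalerAr mcoeffZ sqX.
under eq_bigr do rewrite mcoeffZ mcoeffX.
have [le_um | nle_um] := boolP (u *+ 2 <= m)%MM.
  pose b0 : {ffun 'I_N -> 'I_D.+1} := [ffun i => inord (u i)].
  have b0E : mnm_of b0 = u.
    apply/mnmP=> i; rewrite mnmE ffunE inordK // ltnS.
    move/mnm_lepP/(_ i): le_um; rewrite mulmnE; have := le_mD i; lia.
  rewrite (bigD1 b0) ?fitsP ?b0E //= eqxx mulr1 big1 ?addr0 => [|b].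
    by have := mcoeffMX P (u *+ 2)%MM (m - u *+ 2)%MM; 
       rewrite addmC submK // => ->; rewrite mulrC.
  case/andP=> _ ne_b; case: eqP => [eq_b|]; last by rewrite !mulr0.
  case/eqP: ne_b; apply/ffunP=> i; apply: val_inj; move: eq_b; rewrite -b0E.
  by move/mnmP/(_ i); rewrite !mnmE.
rewrite big1 => [|b]; last first.
  rewrite fitsP => fit; case: eqP => [eq_b|]; last by rewrite !mulr0.
  by rewrite -eq_b (negPf nle_um) in fit.
suff -> : (P * 'X_[u *+ 2])@_m = 0 by rewrite mulr0.
apply: memN_msupp_eq0; rewrite (perm_mem (msuppMX _ _)); apply/negP => /mapP[v _ mE].
by case/negP: nle_um; rewrite mE lem_addr.
Qed.

End Squares.

Section SplitCauchy.
Variables (F : fieldType) (N n : nat).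
Hypotheses (le_nN : (n <= N)%N) (two0 : (2 : F) != 0).
Local Notation "p ^sq" := (comp_mpoly (squares F N) p) (at level 2, format "p ^sq").

Definition QS (mu : seq nat) : {mpoly F[N]} :=
  Qpoly F N (part_r mu) * (schur F N (part_d mu))^sq.

(** Homogeneity, since the row sums and the column sums of a table have the same total. *)
Lemma genXs_deg phi s m : (size s <= N)%N -> phi 0%N = 1 -> mdeg m != sumn s ->
  (genXs F N phi s)@_m = 0.
Proof.
move=> le_s phi0 ne_deg; rewrite -(genXs_mnp _ phi0 le_s).
pose d := (\sum_i mnp N s i)%N.
have le_d i : (mnp N s i <= d)%N by rewrite /d (bigD1 i) //= leq_addr.
rewrite (mcoeff_genXs _ _ _ le_d) big_pred0 // => A; apply/negP.
case/andP=> /forallP row /forallP col; case/eqP: ne_deg.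
rewrite -(mdeg_mnp le_s) !mdegE.
rewrite -(eq_bigr _ (fun i _ => eqP (col i))) -(eq_bigr _ (fun i _ => eqP (row i))).
exact: exchange_big.
Qed.

Lemma schur_deg k (nu : intpart k) m : (k <= N)%N -> mdeg m != k ->
  (schur F N nu)@_m = 0.
Proof.
move=> le_kN ne_deg; rewrite -[schur _ _ _](subrK (genP F N phi_h nu)).
have [c ->] := schur_in_h F nu le_kN.
have gen0 (ka : intpart k) : (genP F N phi_h ka)@_m = 0.
  rewrite /genP genXs_deg ?sumn_intpart //.
  exact: leq_trans (size_intpart ka) le_kN.
rewrite mcoeffD gen0 addr0 raddf_sum big1 // => ka _ /=.
by rewrite mcoeffZ gen0 mulr0.
Qed.

(** Sort both sides by the exponent b taken from the factor in x^2. For fixed b of degree B, the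
    Cauchy identities for Q in degree n - 2B and for S in degree B give a double sum over pairs
    (rho, nu), which are the (mu^r, mu^d) with mu^d of size B. *)
Lemma split_cauchy m : mdeg m = n ->
  genXs F N phi_hh m =
  \sum_(mu : intpart n) ((2 ^+ size (part_r mu))^-1 * (QS mu)@_m) *: QS mu.
Proof.
move=> deg_m; pose D := mdeg m.
have le_mD i : (m i <= D)%N by rewrite /D mdegE (bigD1 i) //= leq_addr.
under eq_bigr do rewrite /QS (mcoeff_mul_sq _ _ le_mD) mulr_sumr scaler_suml.
rewrite exchange_big /= (genXs_hh F le_mD); apply: eq_bigr => b fit.
have le_bm : (mnm_of b *+ 2 <= m)%MM by rewrite -fitsP.
set B := mdeg (mnm_of b).
have deg_mB : (mdeg (m - mnm_of b *+ 2) + 2 * B = n)%N.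
  by rewrite -deg_m -[in RHS](submK le_bm) mdegD mdegMn mulnC.
have le_B : (2 * B <= n)%N by rewrite -deg_mB leq_addl.
have leBN : (B <= N)%N by lia.
have lenBN : (n - 2 * B <= N)%N by lia.
have deg_q : mdeg (m - mnm_of b *+ 2) = (n - 2 * B)%N by lia.
rewrite (q_cauchy lenBN two0 deg_q) (h_cauchy F leBN (erefl B)).
pose G rho nu : {mpoly F[N]} := ((2 ^+ size rho)^-1 *
   ((Qpoly F N rho)@_(m - mnm_of b *+ 2) * (schur F N nu)@_(mnm_of b))) *:
   (Qpoly F N rho * (schur F N nu)^sq).
rewrite (bigID (fun mu : intpart n => sumn (part_d mu) == B)) /=.
(* The other mu contribute nothing: their Schur factor is homogeneous of a degree different from
   that of the monomial b. *)
rewrite [X in _ = _ + X]big1 ?addr0 => [|mu ne_B]; last first.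
  have mu_part := intpart_is_part mu.
  have [nu nuE] := exists_intpart (part_of_mult_is_part _ _ : is_part (part_d mu))
    (erefl _).
  rewrite -nuE schur_deg ?mulr0 ?scale0r // 1?eq_sym //.
  by have := sumn_part_rd mu_part; rewrite sumn_intpart; lia.
rewrite (big_intpart_rd G le_B) rmorph_sum big_distrl; apply: eq_bigr => rho _ /=.
rewrite big_distrr; apply: eq_bigr => nu _ /=.
by rewrite comp_mpolyZ -scalerAl -scalerAr scalerA /G mulrA.
Qed.

End SplitCauchy.

(** * Determinants of triangular changes of basis *)

(** Ties of the rank are allowed, as needed for the number of parts. The rank cannot increase at
    every point moved by a permutation, because its sum is preserved; so every other term contains a
    zero. *)
Lemma det_rank_trig (R : comNzRingType) p (A : 'M[R]_p) (f : 'I_p -> nat) :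
  (forall i j, i != j -> (f j <= f i)%N -> A i j = 0) -> \det A = \prod_i A i i.
Proof.
move=> A0; rewrite /determinant (bigD1 1%g) //= [X in _ + X]big1 ?addr0.
  by rewrite odd_perm1 mul1r; apply: eq_bigr => i _; rewrite perm1.
move=> s s1; have [i ne_i le_i] : exists2 i, s i != i & (f (s i) <= f i)%N.
  apply/exists_inP; apply: contraNT s1; rewrite negb_exists_in => /forall_inP lt_f.
  have le_f i : true -> (f i <= f (s i) ?= iff (s i == i))%N.
    move=> _; split.
      by case: (eqVneq (s i) i) => [->//|/lt_f]; rewrite -ltnNge => /ltnW.
    by case: (eqVneq (s i) i) => [->|/lt_f]; rewrite ?eqxx // -ltnNge => /ltn_eqF.
  have sum_f : (\sum_i f (s i) = \sum_i f i)%N.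
    by rewrite [RHS](reindex_inj (@perm_inj _ s)).
  have := leqif_sum le_f; rewrite sum_f => -[_]; rewrite eqxx => /esym/forall_inP s_id.
  by apply/eqP/permP=> i; rewrite perm1; apply/eqP/s_id.
by rewrite (bigD1 i) //= A0 1?eq_sym // mul0r mulr0.
Qed.

Lemma prod_half_ord (R : comNzRingType) N (G : 'I_N -> R) :
  \prod_(i < N.*2) G (half_ord i) = \prod_(j < N) G j ^+ 2.
Proof.
rewrite (partition_big (@half_ord N) xpredT) //=; apply: eq_bigr => j _.
have lt0 : (j.*2 < N.*2)%N by rewrite ltn_double.
have lt1 : (j.*2.+1 < N.*2)%N by rewrite ltn_Sdouble.
rewrite (eq_bigr (fun=> G j)) => [|i /eqP-> //]; rewrite prodr_const.
congr (_ ^+ _); rewrite (eq_card (B := pred2 (Ordinal lt0) (Ordinal lt1))).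
  by rewrite card2 -(inj_eq val_inj) /= ltn_eqF.
move=> i; rewrite !inE -!(inj_eq val_inj) /=; have := odd_double_half i.
by case: odd => /=; lia.
Qed.

(** * Doubled variables *)

Section Dup.
Variables (F : fieldType) (N : nat).

Lemma genX_dup r :
  comp_mpoly [tuple 'X_(half_ord i) | i < N.*2] (genX F N.*2 phi_h r) =
  genX F N phi_hh r.
Proof.
pose X (j : 'I_N) : {mpoly F[N]} := 'X_j.
rewrite /genX rmorph_gen (eq_gen _ _ (psi := phi_h) (y := X \o @half_ord N)) //.
  have eP : eq_upto r (\prod_(i < N.*2) ser phi_h r (X (half_ord i)))
      (\prod_(j < N) ser phi_hh r (X j)).
    rewrite (prod_half_ord (fun j => ser phi_h r (X j))); apply: eq_upto_prod => j _.
    by rewrite expr2; apply/ser_mul/phi_hh_h.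
  rewrite /gen; under eq_bigl do rewrite inE; rewrite eP //.
  by congr (polyseq _)`_r; apply: eq_bigl => j; rewrite inE.
by move=> i /=; rewrite comp_mpolyXU -tnth_nth tnth_mktuple.
Qed.

(** Jacobi-Trudi is applied before the variables are identified, whence the order in [N.*2]
    variables. *)
Lemma schur_dup_in_hh n (la : intpart n) : (n <= N)%N ->
  inspan (genP F N phi_hh (k:=n))
    (fun nu : intpart n => (mnp N.*2 la < mnp N.*2 (nu : intpart n))%O)
    (schur_dup F N la - genP F N phi_hh la).
Proof.
move=> le_nN; have le_2N : (n <= N.*2)%N by lia.
have [c cE] := schur_in_h F la le_2N; exists c.
have dupP (ka : intpart n) : comp_mpoly [tuple 'X_(half_ord i) | i < N.*2]
    (genP F N.*2 phi_h ka) = genP F N phi_hh ka.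
  by rewrite /genP /genXs rmorph_prod; apply: eq_bigr => r _; apply: genX_dup.
rewrite -dupP -comp_mpolyB cE raddf_sum; apply: eq_bigr => ka _ /=.
by rewrite comp_mpolyZ dupP.
Qed.

Lemma genX_hh_h r : (0 < r)%N ->
  genX F N phi_hh r = 2 *: genX F N phi_h r +
    \sum_(1 <= a < r) genX F N phi_h a * genX F N phi_h (r - a).
Proof.
case: r => // r _; rewrite /genX (gen_mul _ _ _ phi_hh_h) -/(genX F N phi_h _).
rewrite big_ord_recl big_ord_recr /= subnn subn0 !gen_0 // mul1r mulr1.
rewrite addrCA -mulr2n -scaler_nat addrC; congr (_ + _).
rewrite big_add1 /= big_mkord; apply: eq_bigr => a _.
by rewrite /bump /= add1n.
Qed.

(** In h_r(x, x) the two extreme terms give 2 h_r, and every other term splits r into two positive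
    parts. The prefix t holds the parts already converted, so that the induction covers those
    splittings. *)
Lemma hh_in_h n t s : 0%N \notin t ++ s -> sumn (t ++ s) = n ->
  inspan (genP F N phi_h (k:=n)) (fun nu : intpart n => (size (t ++ s) < size nu)%N)
    (genXs F N phi_h t * genXs F N phi_hh s - 2 ^+ size s *: genXs F N phi_h (t ++ s)).
Proof.
have norm_size u : 0%N \notin u -> size (normalize u) = size u.
  move=> u0; rewrite size_sort (_ : filter _ u = u) //.
  by apply/all_filterP/allP=> r u_r; rewrite lt0n; apply: contraNneq u0 => <-.
elim: s t => [|r s IHs] t ts0 sumn_ts.
  rewrite cats0 scale1r /genXs big_nil mulr1 subrr; exact: inspan0.
have r_gt0 : (0 < r)%N.
  by rewrite lt0n; apply: contraNneq ts0 => <-; rewrite mem_cat mem_head orbT.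
have genXs_cat u v : genXs F N phi_h (u ++ v) = genXs F N phi_h u * genXs F N phi_h v.
  exact: big_cat.
(* The first part of s moves to the prefix, either whole with the factor 2 or split as a, r - a. *)
have -> : genXs F N phi_h t * genXs F N phi_hh (r :: s) -
    2 ^+ size (r :: s) *: genXs F N phi_h (t ++ r :: s) =
  2 *: (genXs F N phi_h (rcons t r) * genXs F N phi_hh s -
         2 ^+ size s *: genXs F N phi_h (rcons t r ++ s)) +
  \sum_(1 <= a < r)
    (genXs F N phi_h (t ++ [:: a; (r - a)%N]) * genXs F N phi_hh s).
  have -> : genXs F N phi_hh (r :: s) = genX F N phi_hh r * genXs F N phi_hh s.
    exact: big_cons.
  have -> : genXs F N phi_h (rcons t r) = genXs F N phi_h t * genX F N phi_h r.
    by rewrite -cats1 genXs_cat {2}/genXs big_seq1.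
  rewrite cat_rcons exprS -scalerA -mulr_suml genX_hh_h //.
  have -> : \sum_(1 <= a < r) genXs F N phi_h (t ++ [:: a; (r - a)%N]) =
      genXs F N phi_h t * \sum_(1 <= a < r) genX F N phi_h a * genX F N phi_h (r - a).
    rewrite mulr_sumr; apply: eq_bigr => a _; rewrite genXs_cat; congr (_ * _).
    by rewrite /genXs big_cons big_seq1.
  move: (genXs F N phi_h t) (genX F N phi_h r) (genXs F N phi_hh s) => gt hr hs.
  by rewrite -!mul_mpolyC; ring.
apply: inspanD.
  apply: inspanZ.
  have := IHs (rcons t r); rewrite cat_rcons; apply=> //.
apply: inspan_sum => a; rewrite mem_index_iota => /andP[a_gt0 lt_ar] _.
rewrite -[X in inspan _ _ X]
  (subrK (2 ^+ size s *: genXs F N phi_h ((t ++ [:: a; (r - a)%N]) ++ s))).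
have t0 : 0%N \notin (t ++ [:: a; (r - a)%N]) ++ s.
  move: ts0; rewrite !mem_cat !inE !negb_or -!andbA => /and3P[-> _ ->].
  rewrite /= andbT; lia.
have t_sum : sumn ((t ++ [:: a; (r - a)%N]) ++ s) = n.
  by rewrite -sumn_ts !sumn_cat /=; lia.
apply: inspanD.
  apply: inspan_sub (IHs _ t0 t_sum) => nu; rewrite !size_cat /=; lia.
apply: inspanZ; apply: inspan_genXs => // nu ->.
by rewrite norm_size // !size_cat /=; lia.
Qed.
End Dup.

(** * The Glaisher correspondence *)

Section Glaisher.
Local Open Scope nat_scope.
Implicit Types s t : seq nat.

Lemma binary_inj P (b c : nat -> bool) :
  \sum_(p < P) b p * 2 ^ p = \sum_(p < P) c p * 2 ^ p ->
  forall p, p < P -> b p = c p.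
Proof.
elim: P b c => // P IHP b c; rewrite !big_ord_recl /=.
have shift (d : nat -> bool) : \sum_(i < P) d (bump 0 i) * 2 ^ bump 0 i =
    2 * \sum_(i < P) d i.+1 * 2 ^ i.
  by rewrite big_distrr; apply: eq_bigr => i _; rewrite /= /bump add1n expnS mulnCA.
rewrite !shift !muln1 => e.
have e0 : b 0 = c 0 by move: e; case: (b 0); case: (c 0) => //=; lia.
have eS : \sum_(i < P) b i.+1 * 2 ^ i = \sum_(i < P) c i.+1 * 2 ^ i.
  by move: e; rewrite e0; lia.
by move=> [|p] //; apply: (IHP (b \o succn) (c \o succn) eS).
Qed.

Lemma odd_part_eq i j p : odd j -> i = 2 ^ p * j -> i`_2^' = j /\ logn 2 i = p.
Proof.
move=> j_odd iE; have j_gt0 : 0 < j by case: j j_odd {iE}.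
have co : coprime 2 j by rewrite coprime2n.
have lE : logn 2 i = p.
  by rewrite iE lognM ?expn_gt0 // pfactorK // logn_coprime ?addn0.
split=> //; have i_gt0 : 0 < i by rewrite iE muln_gt0 expn_gt0.
have := partnC 2 i_gt0; rewrite p_part lE {2}iE => /eqP.
by rewrite eqn_pmul2l ?expn_gt0 // => /eqP.
Qed.

Lemma odd_partK i : 0 < i -> i = 2 ^ logn 2 i * i`_2^'.
Proof. by move=> i_gt0; rewrite -p_part partnC. Qed.

Lemma odd_odd_part i : odd i`_2^'.
Proof. by rewrite -coprime2n; apply: (pnat_coprime (pi := 2)); rewrite ?part_pnat. Qed.

Definition glaisher_mult s j := \sum_(i <- s | i`_2^' == j) 2 ^ logn 2 i.

(** For strict s the multiplicities on the right are binary digits, which [binary_inj] can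
    recover. *)
Lemma glaisher_multE s j P : 0 \notin s -> odd j -> {in s, forall i, i < P} ->
  glaisher_mult s j = \sum_(p < P) count_mem (2 ^ p * j) s * 2 ^ p.
Proof.
move=> s0 j_odd lt_P; rewrite /glaisher_mult.
elim: s s0 lt_P => [|i s IHs]; first by rewrite big_nil big1.
rewrite inE negb_or eq_sym -lt0n => /andP[i_gt0 s0] lt_P.
rewrite big_cons IHs // => [|r s_r]; last by rewrite lt_P // inE s_r orbT.
under [RHS]eq_bigr do rewrite /= mulnDl; rewrite big_split /=.
have [ij | nij] := eqVneq (i`_2^') j; last first.
  rewrite [X in X + _]big1 // => p _; case: eqP => // iE.
  by have [ij _] := odd_part_eq j_odd iE; rewrite ij eqxx in nij.
congr (_ + _); have lt_l : logn 2 i < P.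
  by apply: leq_trans (lt_P i (mem_head _ _)); rewrite ltnW // ltnS ltn_logl.
have iE : i = 2 ^ logn 2 i * j by rewrite -ij -odd_partK.
rewrite (bigD1 (Ordinal lt_l)) //= -iE eqxx mul1n.
rewrite big1 ?addn0 // => p ne_p; case: eqP => // ip.
by have [_ lp] := odd_part_eq j_odd ip; rewrite -(inj_eq val_inj) /= lp eqxx in ne_p.
Qed.

Lemma count_glaisher s j : 0 \notin s ->
  count_mem j (glaisher s) = if odd j then glaisher_mult s j else 0.
Proof.
move=> s0; rewrite count_part_of_mult; case: ifP => // j_le; case: ifP => // j_odd.
rewrite /glaisher_mult big_seq_cond big1 // => i /andP[s_i /eqP ij].
have i_gt0 : 0 < i by rewrite lt0n; apply: contraNneq s0 => <-.
move: j_le; rewrite -ij part_gt0 (leq_trans _ (mem_leq_sumn s_i)) //.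
exact: dvdn_leq (dvdn_part _ _).
Qed.

Lemma sumn_glaisher s : 0 \notin s -> sumn (glaisher s) = sumn s.
Proof.
move=> s0; rewrite (sumn_multiplicity (@part_of_mult_le _ _)).
transitivity (\sum_(j < (sumn s).+1) \sum_(i <- s | i`_2^' == j) i).
  apply: eq_bigr => j _; rewrite count_glaisher //; case: ifP => j_odd.
    rewrite big_distrr big_seq_cond [RHS]big_seq_cond; apply: eq_bigr => i.
    case/andP=> s_i /eqP <- /=; rewrite mulnC -odd_partK //.
    by rewrite lt0n; apply: contraNneq s0 => <-.
  rewrite muln0 big1 // => i /eqP ij.
  by rewrite -ij odd_odd_part in j_odd.
rewrite [RHS]sumnE [RHS]big_seq.
rewrite (exchange_big_dep xpredT) //= big_seq; apply: eq_bigr => i s_i.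
have i_gt0 : 0 < i by rewrite lt0n; apply: contraNneq s0 => <-.
have lt_i : i`_2^' < (sumn s).+1.
  by rewrite ltnS (leq_trans _ (mem_leq_sumn s_i)) // dvdn_leq // dvdn_part.
by rewrite (big_pred1 (Ordinal lt_i)) // => j; rewrite eq_sym -(inj_eq val_inj).
Qed.

(* The Glaisher correspondence on the odd multiplicities, and doubling of the
   halved ones, produce the odd and the even parts of another partition. *)
Definition glaisher_full s :=
  normalize (glaisher (part_r s) ++ [seq i.*2 | i <- part_d s]).

Lemma part_r_pos s : 0 \notin part_r s.
Proof. by case/andP: (part_of_mult_is_part (sumn s) (fun i => odd (count_mem i s))). Qed.

Lemma part_d_pos s : 0 \notin part_d s.
Proof. by case/andP: (part_of_mult_is_part (sumn s) (fun i => (count_mem i s)./2)). Qed.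

Lemma glaisher_pos s : 0 \notin glaisher s.
Proof. by have /andP[] := part_of_mult_is_part _ _ : is_part (glaisher s). Qed.

Lemma double_pos s : 0 \notin [seq i.*2 | i <- part_d s].
Proof.
by apply/mapP=> -[[|i] d_i //] _; move: (part_d_pos s); rewrite d_i.
Qed.

Lemma glaisher_full_perm s :
  perm_eq (glaisher_full s) (glaisher (part_r s) ++ [seq i.*2 | i <- part_d s]).
Proof.
rewrite /glaisher_full /normalize perm_sort; set L := _ ++ _.
suff -> : [seq r <- L | 0 < r] = L by [].
apply/all_filterP/allP=> r; rewrite mem_cat lt0n => /orP[] r_in.
  by apply: contraNneq (glaisher_pos (part_r s)) => <-.
by apply: contraNneq (double_pos s) => <-.
Qed.

Lemma sumn_glaisher_full s : is_part s -> sumn (glaisher_full s) = sumn s.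
Proof.
move=> s_part; rewrite (perm_sumn (glaisher_full_perm s)) sumn_cat.
rewrite sumn_glaisher ?part_r_pos // -(sumn_part_rd s_part); congr (_ + _).
by elim: (part_d s) => [|i d IHd]; rewrite ?muln0 //= IHd; lia.
Qed.

Lemma size_glaisher_full s :
  size (glaisher_full s) = size (glaisher (part_r s)) + size (part_d s).
Proof. by rewrite (perm_size (glaisher_full_perm s)) size_cat size_map. Qed.

Lemma size_part_e_glaisher_full s : size (part_e (glaisher_full s)) = size (part_d s).
Proof.
rewrite size_map size_filter (elimT seq.permP (glaisher_full_perm s)) count_cat.
rewrite (_ : count _ (glaisher _) = 0) ?add0n; last first.
  apply/eqP; rewrite -leqn0 leqNgt -has_count; apply/hasPn=> j /= gl_j.
  move: gl_j; rewrite negbK -has_pred1 has_count count_glaisher ?part_r_pos //.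
  by case: ifP.
rewrite count_map (eq_count (a2 := xpredT)) ?count_predT // => i /=.
by rewrite odd_double.
Qed.

(** Multiplicities of even parts give back those of la^d; multiplicities of odd parts give back la^r
    through uniqueness of binary expansions. *)
Lemma glaisher_full_inj s t : is_part s -> is_part t ->
  glaisher_full s = glaisher_full t -> s = t.
Proof.
move=> s_part t_part eq_g.
have countE u j : is_part u -> count_mem j (glaisher_full u) =
    if odd j then glaisher_mult (part_r u) j else count_mem j./2 (part_d u).
  move=> u_part; rewrite (elimT seq.permP (glaisher_full_perm u)) count_cat.
  rewrite count_glaisher ?part_r_pos // count_map; case: ifP => j_odd.
    rewrite (eq_count (a2 := pred0)) ?count_pred0 ?addn0 // => i /=.
    by apply/eqP=> ij; rewrite -ij odd_double in j_odd.
  by apply: eq_count => i /=; have := odd_double_half j; rewrite j_odd; lia.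
apply: part_rd_inj => //.
  apply: part_ext; rewrite ?part_of_mult_is_part // => i.
  have [-> | i_gt0] := posnP i; first by rewrite !count0_part ?part_of_mult_is_part.
  (* Enough digits for the parts of both partitions and for the digit [logn 2 i] that is
     compared. *)
  set P := (maxn i (maxn (sumn s) (sumn t))).+1.
  have bound u : sumn u < P -> {in part_r u, forall r, r < P}.
    by move=> lt_u r /part_of_mult_le le_r; apply: leq_ltn_trans le_r lt_u.
  have sP : sumn s < P by rewrite ltnS !leq_max leqnn orbT.
  have tP : sumn t < P by rewrite ltnS !leq_max leqnn !orbT.
  have := countE s i`_2^' s_part; rewrite eq_g countE // odd_odd_part.
  rewrite (glaisher_multE (part_r_pos t) (odd_odd_part i) (bound t tP)).
  rewrite (glaisher_multE (part_r_pos s) (odd_odd_part i) (bound s sP)).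
  under eq_bigr do rewrite count_part_r //.
  under [RHS]eq_bigr do rewrite count_part_r //.
  pose bit u p := odd (count_mem (2 ^ p * i`_2^') u).
  move/(@binary_inj P (bit t) (bit s))/(_ (logn 2 i)); rewrite /bit -odd_partK //.
  rewrite !count_part_r // => -> //.
  by rewrite (leq_trans (ltn_logl 2 i_gt0)) // ltnW // ltnS leq_max leqnn.
apply: part_ext; rewrite ?part_of_mult_is_part // => i.
have := countE s i.*2 s_part; rewrite eq_g countE // odd_double doubleK.
by move=> ->.
Qed.

(** An injective map of the finite set of partitions to itself permutes it. Along [glaisher_full],
    l(la^e) becomes l(la^d), and l(la) becomes the number of odd parts plus l(la^d). *)
Lemma glaisher_counts n :
  kn n = \sum_(la : intpart n) size (part_d la) /\
  \sum_(la : intpart n) size (glaisher (part_r la)) =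
  \sum_(la : intpart n) size (part_r la) + kn n.
Proof.
have ex_full (la : intpart n) :
    exists ka : intpart n, ka = glaisher_full la :> seq nat.
  apply: exists_intpart; first exact: normalize_is_part.
  by rewrite sumn_glaisher_full ?intpart_is_part // sumn_intpart.
have [h hE] := fin_all_exists ex_full.
have h_inj : injective h.
  move=> la ka /(congr1 (@parts n)); rewrite !hE => /glaisher_full_inj e.
  by apply: intpart_inj; apply: e; apply: intpart_is_part.
have kE : kn n = \sum_(la : intpart n) size (part_d la).
  rewrite /kn (reindex_inj h_inj); apply: eq_bigr => la _.
  by rewrite hE size_part_e_glaisher_full.
(* With [kn n] added, both sides count all parts of all partitions: the left through
   [glaisher_full], the right through l(la) = l(la^r) + 2 l(la^d). *)
split=> //; apply: (@addIn (kn n)).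
transitivity (\sum_(la : intpart n) size la).
  rewrite [RHS](reindex_inj h_inj) {1}kE -big_split; apply: eq_bigr => la _.
  by rewrite /= hE size_glaisher_full.
rewrite -addnA addnn -mul2n kE big_distrr -big_split; apply: eq_bigr => la _ /=.
by rewrite size_part_rd // intpart_is_part.
Qed.

End Glaisher.

(** * The determinant *)

Section Matrices.
Variables (F : fieldType) (n : nat).
Implicit Types (f g : intpart n -> {mpoly F[n]}).

Local Notation p := #|{: intpart n}|.

Definition intmx (B : intpart n -> intpart n -> F) : 'M[F]_p :=
  \matrix_(i, j) B (enum_val i) (enum_val j).

Definition coefmx f := intmx (fun la ka => (f la)@_(mnp n ka)).

Lemma big_enum_valE (V : nmodType) (G : intpart n -> V) :
  \sum_(mu : intpart n) G mu = \sum_(i < p) G (enum_val i).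
Proof. by rewrite (reindex _ (onW_bij _ (@enum_val_bij _))). Qed.

Lemma intmx_mul B B' :
  intmx (fun la ka => \sum_mu B la mu * B' mu ka) = intmx B *m intmx B'.
Proof.
apply/matrixP=> i j; rewrite !mxE big_enum_valE; apply: eq_bigr => k _.
by rewrite !mxE.
Qed.

Lemma eq_intmx B B' : (forall la ka, B la ka = B' la ka) -> intmx B = intmx B'.
Proof. by move=> eB; apply/matrixP=> i j; rewrite !mxE. Qed.

Lemma coefmx_tr f : (coefmx f)^T = intmx (fun la mu => (f mu)@_(mnp n la)).
Proof. by apply/matrixP=> i j; rewrite !mxE. Qed.

Lemma coefmx_mul f g B :
  (forall la, f la = \sum_mu B la mu *: g mu) -> coefmx f = intmx B *m coefmx g.
Proof.
move=> fE; rewrite -intmx_mul; apply: eq_intmx => la ka.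
by rewrite fE raddf_sum; apply: eq_bigr => mu _; rewrite /= mcoeffZ.
Qed.

Lemma det_intmx (r : intpart n -> nat) B :
    (forall la ka, la != ka -> (r ka <= r la)%N -> B la ka = 0) ->
  \det (intmx B) = \prod_la B la la.
Proof.
move=> B0; rewrite (det_rank_trig (f := fun i => r (enum_val i))) => [|i j].
  rewrite [RHS](reindex _ (onW_bij _ (@enum_val_bij _))).
  by apply: eq_bigr => i _; rewrite mxE.
by rewrite -(inj_eq enum_val_inj) mxE => ne le; apply: B0.
Qed.

Lemma det_coefmx (r : intpart n -> nat) (P : intpart n -> pred (intpart n)) a f g :
    (forall la ka, P la ka -> (r la < r ka)%N) ->
    (forall la, inspan g (P la) (f la - a la *: g la)) ->
  \det (coefmx f) = (\prod_la a la) * \det (coefmx g).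
Proof.
move=> Pr fg; have [c cE] := fin_all_exists fg.
pose B la mu := a la *+ (mu == la) + (if P la mu then c la mu else 0).
have fE la : f la = \sum_mu B la mu *: g mu.
  rewrite -[LHS](subrK (a la *: g la)) cE addrC.
  under [RHS]eq_bigr do rewrite scalerDl; rewrite big_split /=; congr (_ + _).
    rewrite (bigD1 la) //= eqxx mulr1n big1 ?addr0 // => mu /negPf->.
    by rewrite mulr0n scale0r.
  by rewrite big_mkcond; apply: eq_bigr => mu _; case: ifP => _; rewrite ?scale0r.
rewrite (coefmx_mul fE) det_mulmx (det_intmx (r := r)) => [|la ka ne le].
  congr (_ * _); apply: eq_bigr => la _; rewrite /B eqxx mulr1n.
  by case: ifP => [/Pr|]; rewrite ?ltnn ?addr0.
rewrite /B eq_sym (negPf ne) mulr0n add0r; case: ifP => // /Pr.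
by rewrite ltnNge le.
Qed.

(** A numerical rank for [det_intmx]; N is a parameter because the order is used in n and in 2n
    variables. *)
Definition lexrank N (la : intpart n) : nat :=
  #|[pred nu : intpart n | mnp N nu < mnp N la]%O|.

Lemma lexrank_lt N (la ka : intpart n) :
  (mnp N la < mnp N ka)%O -> (lexrank N la < lexrank N ka)%N.
Proof.
move=> lt; apply: proper_card; apply/properP; split.
  by apply/subsetP=> nu; rewrite !inE => /lt_trans; apply.
by exists la; rewrite !inE ?ltxx.
Qed.

(** Schur polynomials have no monomial above their leading one, so it is the transposed matrix that
    is triangular for the rank. *)
Lemma det_schur : \det (coefmx (fun la => schur F n la)) = 1.
Proof.
rewrite -det_tr coefmx_tr (det_intmx (r := lexrank n)) => [|la ka ne le].
  by rewrite big1 // => la _; have [_ ->] := schur_lead F la (leqnn n).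
apply: mcoeff_gt_mlead; have [-> _] := schur_lead F ka (leqnn n).
case: (ltgtP (mnp n ka) (mnp n la)) => // [/lexrank_lt | /(mnp_inj (leqnn n)) e].
  by rewrite ltnNge le.
by rewrite e eqxx in ne.
Qed.

Lemma det_h : \det (coefmx (genP F n phi_h (k:=n))) = 1.
Proof.
pose s (la : intpart n) := schur F n la.
have -> : coefmx (genP F n phi_h (k:=n)) = (coefmx s)^T *m coefmx s.
  rewrite coefmx_tr -intmx_mul; apply: eq_intmx => la ka.
  have deg_la : mdeg (mnp n la) = n.
    by rewrite mdeg_mnp ?size_intpart // sumn_intpart.
  rewrite /genP -(genXs_mnp _ _ (size_intpart la)) //.
  rewrite (h_cauchy F (leqnn n) deg_la).
  by rewrite raddf_sum; apply: eq_bigr => mu _; rewrite /= mcoeffZ.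
by rewrite det_mulmx det_tr det_schur mul1r.
Qed.

Lemma det_hh :
  \det (coefmx (genP F n phi_hh (k:=n))) = \prod_(la : intpart n) 2 ^+ size la.
Proof.
rewrite (det_coefmx (r := fun la => size la)
   (P := fun la ka : intpart n => (size la < size ka)%N)
   (a := fun la => 2 ^+ size la) (g := genP F n phi_h (k:=n))) //.
  by rewrite det_h mulr1.
move=> la; have /andP[_ la0] := intpart_is_part la.
have := hh_in_h F (n := n) (t := [::]) (s := la) n la0 (sumn_intpart la).
by rewrite /genXs big_nil mul1r.
Qed.

Lemma det_dup :
  \det (coefmx (fun la => schur_dup F n la)) = \prod_(la : intpart n) 2 ^+ size la.
Proof.
rewrite (det_coefmx (r := lexrank n.*2) (P := fun la ka : intpart n =>
   (mnp n.*2 la < mnp n.*2 ka)%O) (a := fun=> 1) (g := genP F n phi_hh (k:=n))).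
- by rewrite det_hh big1_eq mul1r.
- exact: lexrank_lt.
by move=> la; rewrite scale1r; apply: schur_dup_in_hh.
Qed.

Hypothesis two0 : (2 : F) != 0.

Lemma det_QS :
  \det (coefmx (genP F n phi_hh (k:=n))) =
  \det (coefmx (fun la => QS F n la)) ^+ 2 *
  \prod_(mu : intpart n) (2 ^+ size (part_r mu))^-1.
Proof.
pose d (mu ka : intpart n) : F :=
  if mu == ka then (2 ^+ size (part_r mu))^-1 else 0.
pose q (mu : intpart n) := QS F n mu.
have -> : coefmx (genP F n phi_hh (k:=n)) = (coefmx q)^T *m (intmx d *m coefmx q).
  rewrite coefmx_tr -!intmx_mul; apply: eq_intmx => la ka.
  have deg_la : mdeg (mnp n la) = n.
    by rewrite mdeg_mnp ?size_intpart // sumn_intpart.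
  rewrite /genP -(genXs_mnp _ _ (size_intpart la)) //.
  rewrite (split_cauchy (leqnn n) two0 deg_la) raddf_sum.
  apply: eq_bigr => mu _ /=; rewrite mcoeffZ.
  rewrite (bigD1 mu) //= big1 ?addr0 => [|nu ne]; last first.
    by rewrite /d eq_sym (negPf ne) mul0r.
  by rewrite /d eqxx mulrA [X in X * _]mulrC.
rewrite !det_mulmx det_tr (det_intmx (r := fun=> 0%N) (B := d)).
  by rewrite mulrCA -expr2 mulrC; congr (_ * _); apply: eq_bigr => mu _;
     rewrite /d eqxx.
by move=> la ka; rewrite /d => /negPf->.
Qed.

(** With H = det [hh], Delta the product of the 2^l(mu^r) and q = det [QS], the relations are det A
    * q = H and H * Delta = q^2, while counting parts gives H = Delta * (2^k_n)^2. *)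
Lemma transition_det (A : 'M[F]_p) : is_transition A ->
  \det A ^+ 2 = (2 ^+ kn n) ^+ 2.
Proof.
move=> trA; have pos (mu : intpart n) : is_part mu := intpart_is_part mu.
have dupE (la : intpart n) : schur_dup F n la =
    \sum_(mu : intpart n) A (enum_rank la) (enum_rank mu) *: QS F n mu.
  apply/eqP; rewrite -tofrac_eq trA rmorph_sum; apply/eqP; apply: eq_bigr => mu _.
  have size_r : (size (part_r mu) <= n)%N.
    have := size_part_rd (pos mu); have := size_intpart mu; lia.
  rewrite schurQ_Qpoly ?strict_part_r ?part_r_pos // -!tofracM mul_mpolyC.
  by [].
have AE : A = intmx (fun la mu => A (enum_rank la) (enum_rank mu)).
  by apply/matrixP=> i j; rewrite mxE !enum_valK.
have := congr1 determinant (coefmx_mul dupE).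
rewrite -AE det_mulmx det_dup => detA.
have h0 : \prod_(la : intpart n) 2 ^+ size la != 0 :> F.
  by apply/prodf_neq0=> la _; rewrite expf_neq0.
have d0 : \prod_(mu : intpart n) 2 ^+ size (part_r mu) != 0 :> F.
  by apply/prodf_neq0=> la _; rewrite expf_neq0.
have := det_QS; rewrite det_hh prodfV => qE.
have kE : \prod_(la : intpart n) 2 ^+ size la =
   \prod_(mu : intpart n) 2 ^+ size (part_r mu) * (2 ^+ kn n) ^+ 2 :> F.
  have [-> _] := glaisher_counts n.
  rewrite !prodrXr -!exprM -exprD; congr (_ ^+ _).
  rewrite mulnC big_distrr -big_split; apply: eq_bigr => mu _ /=.
  by rewrite size_part_rd.
set q := \det (coefmx (fun la => QS F n la)) in detA qE.
(* Only the explicit powers of 2 are cancelled, so det [QS] need not be shown nonzero separately. *)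
apply: (mulfI d0); rewrite -kE; apply: (mulfI h0).
by rewrite {1}qE mulrA divfK // -exprMn [q * _]mulrC -detA expr2.
Qed.

End Matrices.

Theorem theorem4p6 (C : numClosedFieldType) (n : nat) :
  (forall A : 'M[C]_#|{: intpart n}|, is_transition A ->
     `|\det A| = 2%:R ^+ kn n) /\
  (kn n)%:Z =
    \sum_(la : intpart n)
      ((size (glaisher (part_r la)))%:Z - (size (part_r la))%:Z).
Proof.
split=> [A trA|].
  have two0 : (2 : C) != 0 by rewrite pnatr_eq0.
  (* The sign of det A is lost in the square; two nonnegative numbers with equal squares agree. *)
  apply/eqP; rewrite -(eqrXn2 (n := 2)) ?normr_ge0 ?exprn_ge0 //.
  by rewrite -normrX (transition_det two0 trA) normrX normrX normr_nat.
have [_ cE] := glaisher_counts n.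
have sumZ (f : intpart n -> nat) : \sum_la (f la)%:Z = (\sum_la f la)%N%:Z.
  by rewrite (big_morph Posz PoszD (erefl 0%:Z)).
by rewrite sumrB !sumZ cE PoszD addrAC subrr add0r.
Qed.
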